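(* Let $X\subset\mathbb P_n$ be the Veronese (rational normal) curve of degree $n\ge1$. Apart from $R_{0,0}=\mathbb C$, the only nonzero syzygies of the coordinate algebra of $X$ are $R_{p,p+1}\simeq\pi_{[2,1^{p-1}]}$, $p\ge1$, where $\pi_{[2,1^{p-1}]}$ is taken as a $\mathrm{GL}(W)$-module with $\dim W=n-1$, and $$\dim R_{p,p+1}=p\cdot\binom{n}{p+1}.$$
   Context: The Veronese curve is the image of $\mathbb P_1\hookrightarrow\mathbb P_n$, $(u_0:u_1)\mapsto(u_0^n:u_0^{n-1}u_1:\dots:u_1^n)$. Its coordinate algebra is $A=\mathbb C[x_0,\dots,x_n]/(x_ix_j-x_kx_m\mid i+j=k+m)$. $R_{p,q}$ is the internal degree $q$ component of $\mathrm{Tor}_p^S(A,\mathbb C)$, $S=\mathbb C[x_0,\dots,x_n]$. $W$ is an $(n-1)$-dimensional vector space (spanned by the dual variables $x^1,\dots,x^{n-1}$), and $\pi_{[2,1^{p-1}]}$ is the irreducible polynomial $\mathrm{GL}(W)$-module whose highest weight is given by the Young diagram with one row of length 2 followed by $p-1$ rows of length 1 (zero if this has more than $\dim W$ rows); the isomorphism $R_{p,p+1}\simeq\pi_{[2,1^{p-1}]}$ is one of vector spaces. *)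

(* Defs.v *)
(* Written on top of MathComp; R[i], for R a realType, plays the role of the
   complex numbers. *)
From HB Require Import structures.
From mathcomp Require Export all_boot all_order all_algebra.
From mathcomp Require Export boolp reals complex.
From mathcomp Require Export generic_quotient ring_quotient mpoly.

Set Implicit Arguments.
Unset Strict Implicit.
Unset Printing Implicit Defensive.

Import GRing.Theory.
Local Open Scope ring_scope.
Local Open Scope quotient_scope.

Section VeroneseAlgebra.
Variables (F : fieldType) (n : nat).
Local Notation S := {mpoly F[n.+1]}.

(* MathComp's quotient rings need a boolean ideal membership, hence the
   classical truth value [< _ >]. *)
Definition veronese_ideal : {pred S} := fun f =>
  `[< exists c : 'I_n.+1 -> 'I_n.+1 -> 'I_n.+1 -> 'I_n.+1 -> S,
        f = \sum_(i < n.+1) \sum_(j < n.+1)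
              \sum_(k < n.+1) \sum_(m < n.+1 | (i + j == k + m)%N)
                c i j k m * ('X_i * 'X_j - 'X_k * 'X_m) >].

Fact veronese_ideal_closed : idealr_closed veronese_ideal.
Proof.
split.
- apply/asboolP; exists (fun _ _ _ _ => 0).
  by do 4!rewrite big1 // => ? _; rewrite mul0r.
- apply/negP => /asboolP[c /(congr1 (meval (fun=> 0)))] /eqP.
  rewrite rmorph1; do 4!(rewrite rmorph_sum big1 ?oner_eq0 // => ? _).
  by rewrite rmorphM rmorphB !rmorphM /= !mevalXU !mul0r subrr mulr0.
move=> a f g /asboolP[b ->] /asboolP[c ->]; apply/asboolP.
exists (fun i j k m => a * b i j k m + c i j k m).
do 4!(rewrite mulr_sumr -big_split; apply: eq_bigr => ? _).
by rewrite mulrDl mulrA.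
Qed.

HB.instance Definition _ :=
  isIdealr.Build S veronese_ideal veronese_ideal_closed.

Definition veronese_algebra : comNzRingType := {ideal_quot veronese_ideal}.

Definition veronese_proj : {rmorphism S -> veronese_algebra} :=
  \pi_{ideal_quot veronese_ideal}.

End VeroneseAlgebra.

Section Tor.
Variables (F : fieldType) (n : nat).
Local Notation S := {mpoly F[n]}.

(* For f onto with homogeneous kernel: a resolution of the graded S-module
   A = S / ker f by graded free S-modules F_p of finite rank. F_p has a
   homogeneous basis indexed by 'I_(gr_rank p), with degrees gr_deg p; its
   elements are row vectors, on which the differential F_(p+1) -> F_p acts by
   right multiplication. *)
Record graded_resolution (A : comNzRingType) (f : {rmorphism S -> A}) := {
  gr_rank : nat -> nat;
  gr_deg : forall p, 'I_(gr_rank p) -> nat;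
  gr_aug : 'I_(gr_rank 0) -> A;
  gr_diff : forall p, 'M[S]_(gr_rank p.+1, gr_rank p);
  gr_aug_homog : forall j,
    exists2 s : S, s \is (gr_deg j).-homog & gr_aug j = f s;
  (* entry (i, j) is zero or homogeneous of degree gr_deg i - gr_deg j *)
  gr_diff_homog : forall p i j m, m \in msupp (gr_diff p i j) ->
    (mdeg m + gr_deg j = gr_deg i)%N;
  gr_aug_surj : forall a : A, exists v : 'rV[S]_(gr_rank 0),
    a = \sum_j f (v 0 j) * gr_aug j;
  gr_exact0 : forall v : 'rV[S]_(gr_rank 0),
    \sum_j f (v 0 j) * gr_aug j = 0 <-> exists w, v = w *m gr_diff 0;
  gr_exactS : forall p (v : 'rV[S]_(gr_rank p.+1)),
    v *m gr_diff p = 0 <-> exists w, v = w *m gr_diff p.+1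
}.

Variables (A : comNzRingType) (f : {rmorphism S -> A}).
Variable (G : graded_resolution f).

(* F_p (x)_S F = F_p / (x_0, ..., x_(n-1)) F_p is 'rV[F]_(gr_rank G p), and
   tensoring a matrix with the residue field F keeps its constant terms. *)
Definition tensor_diff p :
    'Hom('rV[F]_(gr_rank G p.+1), 'rV[F]_(gr_rank G p)) :=
  linfun (mulmxr (map_mx (mcoeff 0%MM) (gr_diff G p))).

Definition tensor_deg p (q : nat) : {vspace 'rV[F]_(gr_rank G p)} :=
  <<[seq delta_mx 0%R j | j <- enum 'I_(gr_rank G p) & gr_deg j == q]>>%VS.

Definition tor_cycles p q : {vspace 'rV[F]_(gr_rank G p)} :=
  match p return {vspace 'rV[F]_(gr_rank G p)} with
  | 0 => tensor_deg 0 q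
  | p'.+1 => (tensor_deg p'.+1 q :&: lker (tensor_diff p'))%VS
  end.

Definition tor_boundaries p q : {vspace 'rV[F]_(gr_rank G p)} :=
  (tensor_diff p @: tensor_deg p.+1 q)%VS.

(* The degree q component of Tor_p^S(A, F), i.e. cycles modulo boundaries.
   MathComp has no quotients of vector spaces; the quotient is represented by
   the complement of the boundaries in the cycles. *)
Definition tor p q : vectType F :=
  subvs_of (tor_cycles p q :\: tor_boundaries p q)%VS.

End Tor.

Definition vect_iso (F : fieldType) (U V : vectType F) : Prop :=
  exists phi : {linear U -> V}, bijective phi.

Section PolynomialRepresentations.
Variables (F : fieldType) (m : nat) (V : vectType F).

(* GL_m(F) is the set unitmx of invertible matrices; the values of rho outside
   of it are irrelevant. *)
Variable rho : 'M[F]_m -> 'End(V).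

Definition is_representation : Prop :=
  rho 1%:M = \1%VF /\
  {in unitmx &, forall g h, rho (g *m h) = (rho g \o rho h)%VF}.

Definition is_polynomial : Prop :=
  forall (l : {linear V -> F^o}) (v : V), exists P : {mpoly F[m * m]},
    {in unitmx, forall g, l (rho g v) = P.@[fun k => mxvec g 0 k]}.

Definition is_irreducible : Prop :=
  (fullv : {vspace V}) != 0%VS /\
  forall U : {vspace V}, {in unitmx, forall g, (rho g @: U <= U)%VS} ->
    U = 0%VS \/ U = fullv.

(* The unipotent upper triangular matrices fix the highest weight vector v,
   and diag(t_1, ..., t_m) scales it by the product of the t_i ^ lambda_i. *)
Definition has_highest_weight (lambda : seq nat) : Prop :=
  exists2 v : V, v != 0 &
    (forall g : 'M[F]_m, (forall i, g i i = 1) ->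
       (forall i j : 'I_m, (j < i)%N -> g i j = 0) -> rho g v = v) /\
    (forall t : 'rV[F]_m, (forall i, t 0 i != 0) ->
       rho (diag_mx t) v = (\prod_i t 0 i ^+ nth 0%N lambda i) *: v).

End PolynomialRepresentations.

(* V is (the underlying space of) the irreducible polynomial GL_m(F)-module
   pi_lambda; this module is zero when lambda has more than m rows. *)
Definition is_pi (F : fieldType) (m : nat) (lambda : seq nat)
    (V : vectType F) : Prop :=
  if (size lambda <= m)%N then
    exists rho : 'M[F]_m -> 'End(V),
      [/\ is_representation rho, is_polynomial rho, is_irreducible rho
        & has_highest_weight rho lambda]
  else (fullv : {vspace V}) = 0%VS.

(* Main.v *)
From HB Require Import structures.
From mathcomp Require Import all_fingroup zify ring.
Require Import Defs.
Import GRing.Theory Num.Theory.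
Set Implicit Arguments.
Unset Strict Implicit.
Unset Printing Implicit Defensive.
Local Open Scope ring_scope.

(** Two facts carry the proof: the Betti numbers of the rational normal curve,
    computed from an arbitrary graded free resolution, and the dimension and
    irreducibility of a concrete model of the hook module.

    For the first, let S be the polynomial ring, G a graded free resolution of
    the Veronese algebra A, and kill the variables x_0, x_n, x_1, ..., x_(n-1)
    of G one after the other. If C is a complex of free modules and x a
    variable that has not been killed yet, then the sequence
    0 -> C -> C -> C/xC -> 0, with first map the multiplication by x, is exact,
    and its long homology sequence determines the graded dimensions of H(C/xC)
    from those of H(C) and the ranks of x on H(C) (lemma [hdim_step]).
    These ranks can be read off numerically. On H_0 the Hilbert functions are
    known at each stage, because H_0 is the quotient of A by the variables
    killed so far; they are computed with the torus weights, A_q having one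
    basis vector for each weight k <= n q ([hdim_H0]). On H_p with p > 0 either
    x_0, x_n are being killed and there is no homology, or the homology lives
    only in degree p + 1 and x acts as zero for degree reasons. When all
    variables are gone the complex is G tensored with the residue field, and the
    recursion has become Pascal's rule ([hdim_cut]).

    For the second, with m = n - 1 and p = r + 1, the hook module is modelled by
    the tensors T in the (r+2)-fold power of F^m that alternate in the last r + 1
    places and satisfy the Garnir relation: T is the sum of its r + 1 transforms
    under the swaps of the first place with another one. The antisymmetrization T minus
    that sum maps the tensors that alternate in the last places onto the totally
    alternating ones, which yields the dimension ([fdim_in_hook]).
    The highest weight vector is the product of an entry and a maximal minor of
    a matrix with r + 1 columns, evaluated at the identity.
    Irreducibility ([hook_irreducible]) rests on one claim: every nonzero
    invariant subspace contains the highest weight vector ([hw_in]). If U were a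
    proper nonzero invariant subspace, its orthogonal in the hook module for the
    standard bilinear form would be another one, since transposes of invertible matrices
    are invertible; then the highest weight vector, whose coordinates are real,
    would be orthogonal to itself. *)

(** * Finite-dimensional subspaces given by predicates *)

Section Dimension.
Variable F : fieldType.
Implicit Types V W : lmodType F.

Definition subspace V (P : V -> Prop) :=
  P 0 /\ forall (a : F) u v, P u -> P v -> P (a *: u + v).

(** Subspaces are predicates, because the graded pieces of a free module sit in
    an infinite-dimensional space, where vspaces are not available. *)
Definition fdim V (P : V -> Prop) (d : nat) :=
  exists2 phi : {linear 'rV[F]_d -> V},
    injective phi & forall v, P v <-> exists x, v = phi x.

Lemma fdim_ext V (P Q : V -> Prop) d :
  (forall v, P v <-> Q v) -> fdim P d -> fdim Q d.
Proof.
move=> PQ [phi phi_inj phiP]; exists phi => // v.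
by rewrite -PQ; apply: phiP.
Qed.

Lemma linear_inj V W (f : {linear V -> W}) :
  (forall v, f v = 0 -> v = 0) -> injective f.
Proof.
move=> f0 u v uv; apply/eqP; rewrite -subr_eq0; apply/eqP/f0.
by rewrite linearB uv subrr.
Qed.

(** A vspace of maximal dimension inside P is all of P: adding the line of
    a further vector of P would increase its dimension. *)
Lemma subspace_vspace (E : vectType F) (P : E -> Prop) :
  subspace P -> exists U : {vspace E}, forall v, P v <-> v \in U.
Proof.
move=> [P0 Plin].
pose D k := `[< exists2 U : {vspace E},
  (forall v, v \in U -> P v) & \dim U = k >].
have D0 : exists k, D k.
  exists 0%N; apply/asboolP; exists 0%VS; last by rewrite dimv0.
  by move=> v; rewrite memv0 => /eqP->.
have Dle k : D k -> (k <= \dim {:E})%N.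
  by move=> /asboolP[U _ <-]; apply/dimvS/subvf.
case: (ex_maxnP D0 Dle) => k /asboolP[U UP dimU] kmax.
exists U => v; split=> [Pv|/UP//].
have DUv : D (\dim (U + <[v]>)).
  apply/asboolP; exists (U + <[v]>)%VS => // w.
  move=> /memv_addP[u Uu [_ /vlineP[a ->] ->]].
  by rewrite addrC; apply: Plin => //; apply: UP.
have := kmax _ DUv; rewrite -dimU => le_dim.
have /eqP-> : U == (U + <[v]>)%VS by rewrite eqEdim addvSl.
by apply: (subvP (addvSr _ _)); apply: memv_line.
Qed.

Lemma fdim_vspace (E : vectType F) (U : {vspace E}) V (psi : {linear E -> V}) :
  (forall x, x \in U -> psi x = 0 -> x = 0) ->
  fdim (fun v => exists2 x, x \in U & v = psi x) (\dim U).
Proof.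
move=> psi0.
pose e (x : 'rV[F]_(\dim U)) : E :=
  \sum_i x 0 i *: (vbasis U)`_i.
have e_lin : linear e.
  move=> a x y; rewrite /e scaler_sumr -big_split; apply: eq_bigr => i _.
  by rewrite !mxE scalerDl scalerA.
pose eL : {linear _ -> _} := HB.pack e
  (GRing.isLinear.Build _ _ _ _ e e_lin).
have eU x : e x \in U.
  by apply: memv_suml => i _; rewrite memvZ // vbasis_mem // mem_nth ?size_tuple.
have e_inj x : e x = 0 -> x = 0.
  move=> ex0; have /freeP fr := basis_free (vbasisP U).
  by apply/rowP => i; rewrite mxE; apply: fr.
exists (psi \o eL : {linear _ -> _}).
  by apply: linear_inj => x /= ex; apply: e_inj; apply: psi0 ex.
move=> v; split=> [[x xU ->]|[y ->]]; last by exists (e y).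
exists (\row_i coord (vbasis U) i x); rewrite /= {1}(coord_vbasis xU).
by congr (psi _); apply: eq_bigr => i _; rewrite mxE.
Qed.

(** Lifting the images of the unit vectors turns an inclusion between
    parametrized subspaces into a matrix; this gives monotonicity and uniqueness
    of the dimension. *)
Lemma fdim_sub_mx V d d'
    (phi : {linear 'rV[F]_d -> V}) (phi' : {linear 'rV[F]_d' -> V}) :
  injective phi -> (forall x, exists y, phi x = phi' y) ->
  exists2 M : 'M[F]_(d, d'), row_free M & forall x, phi x = phi' (x *m M).
Proof.
move=> phi_inj sub; have /choice[g gE] := sub.
have ME x : phi x = phi' (x *m \matrix_i g (delta_mx 0 i)).
  rewrite mulmx_sum_row {1}(row_sum_delta x) !linear_sum.
  by apply: eq_bigr => i _; rewrite !linearZ /= rowK gE.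
exists (\matrix_i g (delta_mx 0 i)) => //.
rewrite -kermx_eq0; apply/eqP/row_matrixP => i; rewrite row0.
apply: phi_inj; rewrite ME linear0.
have : (row i (kermx (\matrix_i g (delta_mx 0 i)))
         <= kermx (\matrix_i g (delta_mx 0 i)))%MS by apply: row_sub.
by move=> /sub_kermxP->; rewrite linear0.
Qed.

Lemma fdim_le V (P Q : V -> Prop) d d' :
  (forall v, P v -> Q v) -> fdim P d -> fdim Q d' -> (d <= d')%N.
Proof.
move=> PQ [phi phi_inj phiP] [phi' _ phiQ].
have [|M Mfree _] := @fdim_sub_mx V d d' phi phi' phi_inj.
  by move=> x; apply/phiQ/PQ/phiP; exists x.
by rewrite -(eqP Mfree) rank_leq_col.
Qed.

Lemma fdim_uniq V (P : V -> Prop) d d' : fdim P d -> fdim P d' -> d = d'.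
Proof.
by move=> h h'; apply/eqP; rewrite eqn_leq (fdim_le _ h h') // (fdim_le _ h' h).
Qed.

Lemma fdim_eq V (P Q : V -> Prop) d :
  (forall v, P v -> Q v) -> fdim P d -> fdim Q d -> forall v, Q v -> P v.
Proof.
move=> PQ [phi phi_inj phiP] [phi' _ phiQ] v.
have [|M Mfree ME] := @fdim_sub_mx V d d phi phi' phi_inj.
  by move=> x; apply/phiQ/PQ/phiP; exists x.
move=> /phiQ[y ->]; apply/phiP; exists (y *m invmx M).
by rewrite ME mulmxKV // -row_free_unit.
Qed.

Lemma fdim_sub V (P Q : V -> Prop) d :
  subspace P -> (forall v, P v -> Q v) -> fdim Q d -> exists k, fdim P k.
Proof.
move=> [P0 Plin] PQ [phi phi_inj phiQ].
have [|U UP] := @subspace_vspace 'rV[F]_d (fun x => P (phi x)).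
  by split=> [|a u v Pu Pv]; rewrite ?linear0 ?linearP //; apply: Plin.
exists (\dim U); apply: fdim_ext (fdim_vspace (psi := phi) (U := U) _).
  move=> v; split=> [[x /UP Px ->]//|Pv].
  by have /phiQ[x vE] := PQ _ Pv; exists x => //; apply/UP; rewrite -vE.
by move=> x _ px; apply: phi_inj; rewrite linear0.
Qed.

Lemma fdim_rank_nullity V W (P : V -> Prop) (f : {linear V -> W}) d :
  fdim P d -> exists k r, [/\ d = (k + r)%N,
    fdim (fun v => P v /\ f v = 0) k &
    fdim (fun w => exists2 v, P v & w = f v) r].
Proof.
move=> [phi phi_inj phiP].
have [|U UP] := @subspace_vspace 'rV[F]_d (fun x => f (phi x) = 0).
  by split=> [|a u v u0 v0]; rewrite ?linear0 // !linearP u0 v0 scaler0 addr0.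
exists (\dim U), (\dim U^C); split.
- by rewrite dimv_compl dimvf /dim /= mul1n subnKC // -[d in leqRHS]mul1n;
    have := dimvS (subvf U); rewrite dimvf.
- apply: fdim_ext (fdim_vspace (psi := phi) (U := U) _).
    move=> v; split=> [[x /UP fx ->]|[/phiP[x ->] fx]].
      by split=> //; apply/phiP; exists x.
    by exists x => //; apply/UP.
  by move=> x _ px; apply: phi_inj; rewrite linear0.
- apply: fdim_ext (fdim_vspace (psi := f \o phi) (U := U^C%VS) _).
    move=> w; split=> [[x _ ->]|[_ /phiP[x ->] ->]].
      by exists (phi x) => //; apply/phiP; exists x.
    have : x \in (U + U^C)%VS by rewrite addv_complf memvf.
    move=> /memv_addP[u uU [v vU ->]]; exists v => //=.
    by rewrite !linearD /= (iffRL (UP u) uU) add0r.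
  move=> x xC /UP xU; apply/eqP; rewrite -memv0 -(capv_compl U).
  by rewrite memv_cap xU.
Qed.

Lemma fdim_inj V W (P : V -> Prop) (f : {linear V -> W}) d :
  (forall v, P v -> f v = 0 -> v = 0) -> fdim P d ->
  fdim (fun w => exists2 v, P v & w = f v) d.
Proof.
move=> f0 [phi phi_inj phiP]; exists (f \o phi : {linear _ -> _}).
  apply: linear_inj => x fx; apply: phi_inj; rewrite linear0; apply: f0 => //.
  by apply/phiP; exists x.
move=> w; split=> [[_ /phiP[x ->] ->]|[x ->]]; first by exists x.
by exists (phi x) => //; apply/phiP; exists x.
Qed.

(** A subspace that embeds linearly in a coordinate space is parametrized by the
    inverse of that embedding, which is linear by injectivity. *)
Lemma fdim_exists V N (P : V -> Prop) (f : {linear V -> 'rV[F]_N}) :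
  subspace P -> (forall v, P v -> f v = 0 -> v = 0) -> exists d, fdim P d.
Proof.
move=> [P0 Plin] f0.
have [|U UP] := @subspace_vspace 'rV[F]_N (fun x => exists2 v, P v & x = f v).
  split; first by exists 0; rewrite ?linear0.
  move=> a _ _ [u Pu ->] [v Pv ->].
  by exists (a *: u + v); rewrite ?linearP //; apply: Plin.
have fP x : x \in U -> exists v, P v /\ x = f v.
  by move=> /UP[v]; exists v.
have /choice[g gP] : forall x, exists v, x \in U -> P v /\ x = f v.
  move=> x; have [/fP[v ?]|?] := boolP (x \in U); first by exists v.
  by exists 0.
have [gU fg] : (forall x, x \in U -> P (g x)) /\
    (forall x, x \in U -> f (g x) = x).
  by split=> x /gP[].
have f_inj u v : P u -> P v -> f u = f v -> u = v.
  move=> Pu Pv fuv; apply/eqP; rewrite -subr_eq0; apply/eqP/f0.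
    by rewrite -scaleN1r addrC; apply: Plin.
  by rewrite linearB fuv subrr.
pose h x := g (projv U x).
have pU x : projv U x \in U by apply: memv_proj.
have h_lin : linear h.
  move=> a x y; apply: f_inj; [exact: gU|by apply: Plin; exact: gU|].
  by rewrite linearP /h !fg // linearP.
pose hL : {linear _ -> _} := HB.pack h (GRing.isLinear.Build _ _ _ _ h h_lin).
exists (\dim U); apply: fdim_ext (fdim_vspace (psi := hL) (U := U) _).
  move=> v; split=> [[x xU ->]|Pv]; first exact: gU.
  have fvU : f v \in U by apply/UP; exists v.
  by exists (f v) => //=; rewrite /h projv_id //; apply: f_inj; rewrite ?fg//; apply: gU.
move=> x xU /= hx0; rewrite -(fg x xU).
by move: hx0; rewrite /h projv_id // => ->; rewrite linear0.
Qed.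

Definition dimension V (P : V -> Prop) : nat :=
  if pselect (exists d, fdim P d) is left e then projT1 (cid e) else 0%N.

Lemma dimensionE V (P : V -> Prop) d : fdim P d -> dimension P = d.
Proof.
move=> Pd; rewrite /dimension; case: pselect => [e|[]]; last by exists d.
by case: (cid e) => d' /= Pd'; apply: fdim_uniq Pd' Pd.
Qed.

Lemma fdim_dimension V (P : V -> Prop) : (exists d, fdim P d) -> fdim P (dimension P).
Proof. by move=> [d Pd]; rewrite (dimensionE Pd). Qed.

End Dimension.

(** * Selecting the monomials of a polynomial *)

Section Filter.
Variables (F : fieldType) (n : nat).
Local Notation S := {mpoly F[n]}.
Implicit Types (P Q : pred 'X_{1..n}) (f g : S) (I : {set 'I_n}).

Definition mfilter P f : S := \sum_(m <- msupp f | P m) f@_m *: 'X_[m].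

Lemma mcoeff_mfilter P f m : (mfilter P f)@_m = if P m then f@_m else 0.
Proof.
rewrite /mfilter linear_sum /=.
under eq_bigr => k _ do rewrite linearZ /= mcoeffX.
have [mf|mf] := boolP (m \in msupp f); last first.
  rewrite (memN_msupp_eq0 mf) if_same big_seq_cond big1 // => k /andP[kf _].
  by case: eqP kf => [->|]; [rewrite (negPf mf)|rewrite mulr0].
rewrite big_mkcond (bigD1_seq m) ?msupp_uniq //= eqxx mulr1 big1 ?addr0 // => k.
by move=> /negPf->; rewrite mulr0 if_same.
Qed.

Lemma mfilter_is_linear P : linear (mfilter P).
Proof.
move=> a f g; apply/mpolyP => m; rewrite mcoeffD mcoeffZ !mcoeff_mfilter.
by case: (P m); rewrite ?mcoeffD ?mcoeffZ // mulr0 addr0.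
Qed.
HB.instance Definition _ P :=
  GRing.isLinear.Build F S S *:%R (mfilter P) (mfilter_is_linear P).

Lemma mfilter_comp P Q f : mfilter P (mfilter Q f) = mfilter (fun m => P m && Q m) f.
Proof.
apply/mpolyP => m; rewrite !mcoeff_mfilter /=.
by case: (P m).
Qed.

Lemma eq_mfilter P Q f : {in msupp f, P =1 Q} -> mfilter P f = mfilter Q f.
Proof.
move=> PQ; apply/mpolyP => m; rewrite !mcoeff_mfilter.
have [mf|mf] := boolP (m \in msupp f); first by rewrite PQ.
by rewrite (memN_msupp_eq0 mf) !if_same.
Qed.

Lemma mfilter_idP P f : reflect (mfilter P f = f) (all P (msupp f)).
Proof.
apply: (iffP allP) => [fP|<- m]; last first.
  by rewrite mcoeff_msupp mcoeff_mfilter; case: (P m) => //; rewrite eqxx.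
apply/mpolyP => m; rewrite mcoeff_mfilter; case: ifP => // /negP Pm.
by rewrite memN_msupp_eq0 //; apply/negP => /fP.
Qed.

Lemma mfilterX P m : mfilter P 'X_[m] = if P m then 'X_[m] else 0.
Proof.
apply/mpolyP => k; rewrite mcoeff_mfilter mcoeffX.
by case: eqP => [<-|mk]; case: ifP => //; rewrite ?mcoeffX ?eqxx ?mcoeff0 //;
   case: (P m); rewrite ?mcoeffX ?mcoeff0 //; case: eqP.
Qed.

(** Two uses: the substitution of 0 for some variables is multiplicative, and
    the extraction of a homogeneous component commutes with the product by a
    homogeneous polynomial. *)
Lemma mfilterM P Q Q' f g :
  {in msupp f & msupp g, forall m1 m2, P (m1 + m2)%MM = Q m1 && Q' m2} ->
  mfilter P (f * g) = mfilter Q f * mfilter Q' g.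
Proof.
move=> PQ; rewrite {1}(mpolyE f) {1}(mpolyE g) big_distrlr /= linear_sum.
rewrite /mfilter big_distrlr [RHS]big_mkcond /=.
apply: eq_big_seq => m1 m1f; rewrite linear_sum /=.
have -> : (if Q m1 then
    \sum_(j <- msupp g | Q' j) f@_m1 *: 'X_[m1] * (g@_j *: 'X_[j]) else 0) =
    \sum_(j <- msupp g) if Q m1 && Q' j then
       f@_m1 *: 'X_[m1] * (g@_j *: 'X_[j]) else 0.
  by case: (Q m1); rewrite ?big1_eq //= big_mkcond.
apply: eq_big_seq => m2 m2g.
rewrite -!scalerAl -!scalerAr -mpolyXD !linearZ /= mfilterX PQ //.
by case: ifP; rewrite ?scaler0 // => _; rewrite !scalerA mulrC.
Qed.

(** The polynomials supported on these monomials form a copy of the quotient of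
    the polynomial ring by the variables of I, and filtering by [free_of I] is the
    quotient map. *)
Definition free_of I (m : 'X_{1..n}) := [forall i in I, m i == 0%N].

Lemma free_ofD I m1 m2 :
  free_of I (m1 + m2)%MM = free_of I m1 && free_of I m2.
Proof.
apply/forall_inP/andP => [h|[/forall_inP h1 /forall_inP h2] i iI].
  by split; apply/forall_inP => i /h; rewrite mnmDE addn_eq0 => /andP[].
by rewrite mnmDE addn_eq0 h1 ?h2.
Qed.

Lemma free_ofU I J m : free_of (I :|: J) m = free_of I m && free_of J m.
Proof.
apply/forall_inP/andP => [h|[/forall_inP h1 /forall_inP h2] i].
  by split; apply/forall_inP => i iI; apply: h; rewrite inE iI ?orbT.
by rewrite inE => /orP[/h1|/h2].
Qed.

Lemma free_of0 m : free_of set0 m.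
Proof. by apply/forall_inP => i; rewrite inE. Qed.

Lemma free_of_mdeg0 I m : mdeg m = 0%N -> free_of I m.
Proof.
move=> /eqP; rewrite mdeg_eq0 => /eqP->; apply/forall_inP => i _.
by rewrite mnm0E.
Qed.

Lemma free_of1 I i : i \notin I -> free_of I U_(i)%MM.
Proof.
move=> iI; apply/forall_inP => j jI; rewrite mnm1E eqb0.
by apply: contraNneq iI => ->.
Qed.

Lemma mfilter_freeM I f g :
  mfilter (free_of I) (f * g) = mfilter (free_of I) f * mfilter (free_of I) g.
Proof. by apply: mfilterM => m1 m2 _ _; apply: free_ofD. Qed.

Lemma mulX_inj i f : 'X_i * f = 0 -> f = 0 :> S.
Proof.
move=> Xf; apply/mpolyP => m; rewrite mcoeff0.
by rewrite -(mcoeffMX f U_(i)%MM m) mulrC Xf mcoeff0.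
Qed.

Lemma mfilter_divX i f :
  mfilter (free_of [set i]) f = 0 -> exists g, f = 'X_i * g.
Proof.
move=> f0; exists (\sum_(m <- msupp f) f@_m *: 'X_[m - U_(i)]).
rewrite {1}(mpolyE f) big_distrr /= big_seq [RHS]big_seq.
apply: eq_bigr => m mf; rewrite -scalerAr -mpolyXD addmC submK //.
rewrite lep1mP; apply: contraTneq mf => mi0.
have := congr1 (mcoeff m) f0; rewrite mcoeff0 mcoeff_mfilter ifT.
  by move=> ?; apply/negP; rewrite mcoeff_msupp => /eqP.
by apply/forall_inP => j; rewrite inE => /eqP->; rewrite mi0.
Qed.

End Filter.

(** * Killing variables in a graded complex of free modules *)

Section Chains.
Variables (F : fieldType) (n : nat).
Local Notation S := {mpoly F[n]}.
Variables (rk : nat -> nat) (dg : forall p, 'I_(rk p) -> nat).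
Variable D : forall p, 'M[S]_(rk p.+1, rk p).
Arguments dg {p} _.
Hypothesis D_homog : forall p i j m, m \in msupp (D p i j) ->
  (mdeg m + dg j = dg i)%N.
Hypothesis DD : forall p, D p.+1 *m D p = 0.
Local Notation M p := {ffun 'I_(rk p) -> S}.
Implicit Types (p q : nat) (I J : {set 'I_n}).

(** The quotient C/(x_i : i in I)C is realized inside C, by the vectors free of
    the variables of I, with the differential [dif] obtained from D by setting
    these variables to 0. This avoids quotient modules. *)
Definition kill p I (v : M p) : M p := [ffun j => mfilter (free_of I) (v j)].
Definition hpart p q (v : M p) : M p :=
  [ffun j => mfilter (fun m => mdeg m + dg j == q)%N (v j)].
Definition mulX p i (v : M p) : M p := [ffun j => 'X_i * v j].
Definition dif I p (v : M p.+1) : M p :=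
  [ffun j => \sum_i v i * mfilter (free_of I) (D p i j)].

Lemma kill_is_linear p I : linear (@kill p I).
Proof. by move=> a u v; apply/ffunP => j; rewrite !ffunE linearP. Qed.
HB.instance Definition _ p I :=
  GRing.isLinear.Build F (M p) (M p) *:%R (@kill p I) (@kill_is_linear p I).

Lemma hpart_is_linear p q : linear (@hpart p q).
Proof. by move=> a u v; apply/ffunP => j; rewrite !ffunE linearP. Qed.
HB.instance Definition _ p q :=
  GRing.isLinear.Build F (M p) (M p) *:%R (@hpart p q) (@hpart_is_linear p q).

Lemma mulX_is_linear p i : linear (@mulX p i).
Proof.
by move=> a u v; apply/ffunP => j; rewrite !ffunE mulrDr scalerAr.
Qed.
HB.instance Definition _ p i :=
  GRing.isLinear.Build F (M p) (M p) *:%R (@mulX p i) (@mulX_is_linear p i).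

Lemma dif_is_linear I p : linear (@dif I p).
Proof.
move=> a u v; apply/ffunP => j; rewrite !ffunE scaler_sumr -big_split.
by apply: eq_bigr => i _; rewrite !ffunE mulrDl scalerAl.
Qed.
HB.instance Definition _ I p :=
  GRing.isLinear.Build F (M p.+1) (M p) *:%R (@dif I p) (@dif_is_linear I p).

(** Setting more variables to 0 is a morphism of complexes. *)
Lemma kill_dif I J p (v : M p.+1) :
  kill J (dif I v) = dif (I :|: J) (kill J v).
Proof.
apply/ffunP => j; rewrite !ffunE linear_sum; apply: eq_bigr => i _ /=.
rewrite mfilter_freeM mfilter_comp ffunE; congr (_ * _); apply: eq_mfilter => m _.
by rewrite free_ofU andbC.
Qed.

(** The entries of D are homogeneous of the degrees that make the
    differential preserve degrees. *)
Lemma hpart_dif I p q (v : M p.+1) : hpart q (dif I v) = dif I (hpart q v).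
Proof.
apply/ffunP => j; rewrite !ffunE linear_sum; apply: eq_bigr => i _ /=.
rewrite ffunE; set d := mfilter (free_of I) (D p i j).
have {2}<- : mfilter xpredT d = d by apply/mfilter_idP/allP.
apply: mfilterM => m1 m2 _; rewrite andbT => m2D.
have /D_homog <- : m2 \in msupp (D p i j).
  by move: m2D; rewrite !mcoeff_msupp mcoeff_mfilter; case: ifP; rewrite ?eqxx.
by rewrite mdegD addnA.
Qed.

Lemma difK I p (v : M p.+2) : dif I (dif I v) = 0.
Proof.
apply/ffunP => k; rewrite !ffunE.
under eq_bigr => i _ do rewrite ffunE mulr_suml.
rewrite exchange_big big1 //= => j _.
under eq_bigr => i _ do rewrite -mulrA -mfilter_freeM.
rewrite -mulr_sumr -linear_sum /=.
have := congr1 (fun A : 'M_(_, _) => A j k) (DD p).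
by rewrite !mxE => ->; rewrite linear0 mulr0.
Qed.

Lemma dif_mulX I p i (v : M p.+1) : dif I (mulX i v) = mulX i (dif I v).
Proof.
apply/ffunP => j; rewrite !ffunE mulr_sumr; apply: eq_bigr => k _.
by rewrite ffunE mulrA.
Qed.

Lemma mulX_eq0 p i (v : M p) : mulX i v = 0 -> v = 0.
Proof.
move=> Xv; apply/ffunP => j; move/ffunP: Xv => /(_ j); rewrite !ffunE.
exact: mulX_inj.
Qed.

Lemma kill_mulX p I i (v : M p) : i \notin I ->
  kill I (mulX i v) = mulX i (kill I v).
Proof.
move=> iI; apply/ffunP => j; rewrite !ffunE mfilter_freeM mfilterX.
by rewrite free_of1.
Qed.

Lemma kill_mulX0 p i (v : M p) : kill [set i] (mulX i v) = 0.
Proof.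
apply/ffunP => j; rewrite !ffunE mfilter_freeM mfilterX ifF ?mul0r //.
by apply/negP => /forall_inP/(_ i); rewrite inE eqxx mnm1E eqxx => /(_ isT).
Qed.

Lemma hpart_mulX p q i (v : M p) : hpart q.+1 (mulX i v) = mulX i (hpart q v).
Proof.
apply/ffunP => j; rewrite !ffunE.
have {2}<- : mfilter (pred1 U_(i)%MM) 'X_i = 'X_i :> S.
  by rewrite mfilterX /= eqxx.
apply: mfilterM => m1 m2; rewrite msuppX inE => /eqP-> _ /=.
by rewrite eqxx mdegD mdeg1 addSn add0n addSn eqSS.
Qed.

Lemma kill_kill p I J (v : M p) : kill I (kill J v) = kill (I :|: J) v.
Proof.
apply/ffunP => j; rewrite !ffunE mfilter_comp; apply: eq_mfilter => m _.
by rewrite free_ofU.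
Qed.

Lemma kill_hpart p I q (v : M p) : kill I (hpart q v) = hpart q (kill I v).
Proof.
apply/ffunP => j; rewrite !ffunE !mfilter_comp; apply: eq_mfilter => m _.
by rewrite andbC.
Qed.

Lemma hpart_id p q (v : M p) : hpart q (hpart q v) = hpart q v.
Proof.
apply/ffunP => j; rewrite !ffunE mfilter_comp; apply: eq_mfilter => m _.
by rewrite andbb.
Qed.

Definition chain I p q (v : M p) := hpart q v = v /\ kill I v = v.

Lemma chain_subspace I p q : subspace (@chain I p q).
Proof.
split=> [|a u v [hu ku] [hv kv]]; first by split; rewrite linear0.
by split; rewrite linearP /= ?hu ?hv ?ku ?kv.
Qed.

Lemma chainP I p q (v : M p) : chain I q v <->
  forall j m, m \in msupp (v j) -> (mdeg m + dg j = q)%N /\ free_of I m.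
Proof.
split=> [[/ffunP hv /ffunP kv] j m mv|h]; [split|split].
- have /mfilter_idP/allP/(_ _ mv)/eqP// :
    mfilter (fun m => mdeg m + dg j == q)%N (v j) = v j.
  by have := hv j; rewrite ffunE.
- have /mfilter_idP/allP/(_ _ mv)// : mfilter (free_of I) (v j) = v j.
  by have := kv j; rewrite ffunE.
- apply/ffunP => j; rewrite ffunE; apply/mfilter_idP/allP => m /h[/eqP//].
- apply/ffunP => j; rewrite ffunE; apply/mfilter_idP/allP => m /h[//].
Qed.

Lemma chain_dif I p q (v : M p.+1) : chain I q v -> chain I q (dif I v).
Proof.
move=> [hv kv]; split; first by rewrite hpart_dif hv.
by rewrite kill_dif setUid kv.
Qed.

Lemma chain_mulX I p q i (v : M p) : i \notin I ->
  chain I q v -> chain I q.+1 (mulX i v).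
Proof.
by move=> iI [hv kv]; split; rewrite ?hpart_mulX ?hv // kill_mulX ?kv.
Qed.

(** Exactness of 0 -> C -> C -> C/xC -> 0 in the middle. *)
Lemma chain_divX I p q i (v : M p) : i \notin I ->
  chain I q.+1 v -> kill [set i] v = 0 ->
  exists2 u, chain I q u & v = mulX i u.
Proof.
move=> iI [hv kv] iv.
have /choice[g gE] : forall j, exists g, v j = 'X_i * g.
  by move=> j; apply: mfilter_divX; have /ffunP/(_ j) := iv; rewrite !ffunE.
have vE : v = mulX i [ffun j => g j] by apply/ffunP => j; rewrite !ffunE.
exists [ffun j => g j] => //; split; apply/eqP; rewrite -subr_eq0; apply/eqP;
  apply: (@mulX_eq0 _ i); rewrite linearB /=.
  by rewrite -hpart_mulX -vE hv subrr.
by rewrite -kill_mulX // -vE kv subrr.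
Qed.

(** In degree 0 only constants occur, so killing variables changes nothing. *)
Lemma chain0 I J p (v : M p) : chain I 0 v -> chain J 0 v.
Proof.
move=> /chainP h; apply/chainP => j m /h[/eqP].
rewrite addn_eq0 => /andP[/eqP m0 /eqP d0] _.
by rewrite m0 d0; split=> //; apply: free_of_mdeg0.
Qed.

Lemma chain_kill I J p q (v : M p) : chain I q v -> chain (J :|: I) q (kill J v).
Proof.
move=> [hv kv]; split; first by rewrite -kill_hpart hv.
by rewrite kill_kill setUAC setUid -kill_kill kv.
Qed.

Lemma chain_sub I J p q (v : M p) : J \subset I -> chain I q v -> chain J q v.
Proof.
move=> JI /chainP h; apply/chainP => j m /h[-> mI]; split=> //.
by apply/forall_inP => i iJ; apply: (forall_inP mI); apply: (subsetP JI).
Qed.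

Lemma fdim_chain I p q : exists d, fdim (@chain I p q) d.
Proof.
pose T : finType := ('I_(rk p) * 'X_{1..n < q.+1})%type.
pose f (v : M p) : 'rV[F]_#|T| :=
  \row_k (v (enum_val k : T).1)@_(enum_val k : T).2.
have f_lin : linear f.
  by move=> a u v; apply/rowP => k; rewrite !mxE !ffunE mcoeffD mcoeffZ.
pose fL : {linear _ -> _} := HB.pack f (GRing.isLinear.Build _ _ _ _ f f_lin).
apply: (fdim_exists (f := fL)); first exact: chain_subspace.
move=> v /chainP vC fv0; apply/ffunP => j; rewrite ffunE.
apply/mpolyP => m; rewrite mcoeff0; have [mv|/memN_msupp_eq0->//] :=
  boolP (m \in msupp (v j)).
have mq : (mdeg m < q.+1)%N by have [<- _] := vC _ _ mv; rewrite ltnS leq_addr.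
have /rowP/(_ (enum_rank (j, BMultinom mq))) := fv0.
by rewrite !mxE enum_rankK.
Qed.

Definition bdry I p q (v : M p) :=
  exists2 w : M p.+1, chain I q w & v = dif I w.

Definition cyc I p q : M p -> Prop :=
  match p with
  | 0 => fun v => chain I q v
  | p'.+1 => fun v => chain I q v /\ dif I v = 0
  end.

Lemma bdry_cyc I p q (v : M p) : bdry I q v -> cyc I q v.
Proof.
move=> [w wC ->]; have vC := chain_dif wC.
by case: p w wC vC v => [//|p] w wC vC _; split; rewrite ?difK.
Qed.

Lemma cyc_chain I p q (v : M p) : cyc I q v -> chain I q v.
Proof. by case: p v => [//|p] v []. Qed.

Lemma cyc_subspace I p q : subspace (@cyc I p q).
Proof.
have [h0 hL] := chain_subspace I p q.
case: p h0 hL => [//|p] h0 hL; split; first by rewrite /= linear0.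
move=> a u v [hu du] [hv dv]; split; first exact: hL.
by rewrite linearP /= du dv scaler0 addr0.
Qed.

Lemma bdry_subspace I p q : subspace (@bdry I p q).
Proof.
have [h0 hL] := chain_subspace I p.+1 q.
split=> [|a _ _ [u hu ->] [v hv ->]]; first by exists 0; rewrite ?linear0.
by exists (a *: u + v); rewrite ?linearP //; apply: hL.
Qed.

Lemma fdim_cyc I p q : fdim (@cyc I p q) (dimension (@cyc I p q)).
Proof.
apply: fdim_dimension; have [d hd] := fdim_chain I p q.
by apply: fdim_sub hd; [exact: cyc_subspace|exact: cyc_chain].
Qed.

Lemma fdim_bdry I p q : fdim (@bdry I p q) (dimension (@bdry I p q)).
Proof.
apply: fdim_dimension; have [d hd] := fdim_chain I p q.
apply: fdim_sub hd; first exact: bdry_subspace.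
by move=> v /bdry_cyc/cyc_chain.
Qed.

(** The dimension of the homology in homological degree p and internal
    degree q. *)
Definition hdim I p q := (dimension (@cyc I p q) - dimension (@bdry I p q))%N.

Lemma hdimE I p q :
  (hdim I p q + dimension (@bdry I p q))%N = dimension (@cyc I p q).
Proof.
rewrite subnK //.
exact: fdim_le (@bdry_cyc I p q) (fdim_bdry I p q) (fdim_cyc I p q).
Qed.

Lemma dim_chainE I p q : dimension (@chain I p.+1 q) =
  (dimension (@cyc I p.+1 q) + dimension (@bdry I p q))%N.
Proof.
have [d hd] := fdim_chain I p.+1 q; rewrite (dimensionE hd).
have [k [r [-> hk hr]]] := fdim_rank_nullity (@dif I p) hd.
by congr (_ + _)%N; symmetry; apply: dimensionE.
Qed.

Section Step.
Variables (I : {set 'I_n}) (i : 'I_n).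
Hypothesis iI : i \notin I.
Local Notation I' := (i |: I).

Lemma dim_chain_step p q : dimension (@chain I p q.+1) =
  (dimension (@chain I' p q.+1) + dimension (@chain I p q))%N.
Proof.
have [d hd] := fdim_chain I p q.+1; rewrite (dimensionE hd).
have [k [r [-> hk hr]]] := fdim_rank_nullity (@kill p [set i]) hd.
rewrite addnC; congr (_ + _)%N; symmetry; apply: dimensionE.
  apply: fdim_ext hr => v; split=> [[w wC ->]|vC]; first exact: chain_kill.
  exists v; first by apply: chain_sub vC; apply: subsetUr.
  have [_ <-] := vC; by rewrite /= kill_kill setUA setUid.
have [c hc] := fdim_chain I p q.
have hX : fdim (fun w => exists2 v, @chain I p q v & w = mulX i v) c.
  by apply: fdim_inj hc => v _; apply: mulX_eq0.
rewrite (fdim_uniq hk (fdim_ext _ hX)) // => v; split=> [[u uC ->]|[vC v0]].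
  by split; [apply: chain_mulX|apply: kill_mulX0].
exact: chain_divX.
Qed.

(** Modulo boundaries, these are the classes in degree q killed by x_i: the kernel of
    x_i on homology has dimension that of [bdry_colon] minus that of [bdry]. *)
Let bdry_colon p q v := @chain I p q v /\ @bdry I p q.+1 (mulX i v).

(** The quotient map sends boundaries onto boundaries, and its kernel on them
    is x_i times [bdry_colon]. *)
Lemma dim_bdry_step p q : exists s, [/\ fdim (@bdry_colon p q) s &
  dimension (@bdry I p q.+1) = (s + dimension (@bdry I' p q.+1))%N].
Proof.
have hd := fdim_bdry I p q.+1.
have [k [r [-> hk hr]]] := fdim_rank_nullity (@kill p [set i]) hd.
have [c hc] := fdim_chain I p q.
have [s hs] : exists s, fdim (@bdry_colon p q) s.
  apply: fdim_sub hc => [|v []//].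
  have [c0 cL] := chain_subspace I p q.
  have [b0 bL] := bdry_subspace I p q.+1.
  split=> [|a u v [uc ub] [vc vb]]; first by split; rewrite ?linear0.
  by split; rewrite ?linearP; [exact: cL|exact: bL].
exists s; split=> //; congr (_ + _)%N; last first.
  symmetry; apply: dimensionE; apply: fdim_ext hr => v.
  split=> [[_ [w wC ->] ->]|[w wC ->]].
    exists (kill [set i] w); first exact: chain_kill.
    by rewrite /= kill_dif setUC.
  exists (dif I w).
    by exists w => //; apply: chain_sub wC; apply: subsetUr.
  rewrite /= kill_dif setUC; congr (dif _ _).
  by have [_ <-] := wC; rewrite /= kill_kill setUA setUid.
have hX : fdim (fun w => exists2 v, @bdry_colon p q v & w = mulX i v) s.
  by apply: fdim_inj hs => v _; apply: mulX_eq0.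
rewrite (fdim_uniq hk (fdim_ext _ hX)) // => v.
split=> [[u [uC ub] ->]|[vb v0]]; first by split => //; apply: kill_mulX0.
have vC := cyc_chain (bdry_cyc vb).
by have [u uC vE] := chain_divX iI vC v0; exists u => //; split; rewrite -?vE.
Qed.

Lemma bdry_colon_cyc p q v : @bdry_colon p q v -> cyc I q v.
Proof.
case: p v => [|p] v [vC /bdry_cyc //= [_ dv]]; split=> //.
by move: dv; rewrite dif_mulX => /mulX_eq0.
Qed.

Lemma bdry_in_colon p q v : bdry I q v -> @bdry_colon p q v.
Proof.
move=> vb; split; first exact: cyc_chain (bdry_cyc vb).
by have [w wC ->] := vb; exists (mulX i w); rewrite ?dif_mulX //;
  apply: chain_mulX.
Qed.

Lemma hdim_step0 p : hdim I' p 0 = hdim I p 0.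
Proof.
have d0 p' (w : M p'.+1) : chain I' 0 w -> dif I' w = dif I w.
  move=> wC; have [_ kd] := chain0 I' (chain_dif (chain0 I wC)).
  by rewrite -kd kill_dif setUCA setUid; have [_ ->] := wC.
rewrite /hdim; congr (_ - _)%N; symmetry; apply: dimensionE.
  apply: fdim_ext (fdim_cyc I' p 0) => v.
  case: p v => [|p] v /=; first by split; apply: chain0.
  split=> [[vC dv]|[vC dv]]; split; try exact: chain0 vC.
    by rewrite -d0.
  by rewrite d0 //; apply: chain0 vC.
apply: fdim_ext (fdim_bdry I' p 0) => v.
split=> [[w wC ->]|[w wC ->]].
  by exists w; [exact: chain0 wC|rewrite d0].
have wC' := chain0 I' wC.
by exists w => //; rewrite d0.
Qed.

(** The long homology sequence in numerical form; rho p q is the rank of x_i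
    from H_(p,q) to H_(p,q+1). Its definition as the difference of the dimensions
    of [cyc] and [bdry_colon] reduces the two equalities to rank-nullity
    counts for chains, cycles and boundaries. *)
Lemma hdim_step : exists rho : nat -> nat -> nat, [/\
  forall p q, (hdim I' p.+1 q.+1 + rho p.+1 q + rho p q =
               hdim I p.+1 q.+1 + hdim I p q)%N,
  forall q, (hdim I' 0 q.+1 + rho 0 q)%N = hdim I 0 q.+1,
  forall p q, (rho p q <= hdim I p q)%N &
  forall p q, hdim I p q.+1 = 0%N -> rho p q = 0%N].
Proof.
have /choice[s sP] : forall p, exists s, forall q,
    fdim (@bdry_colon p q) (s q) /\
    dimension (@bdry I p q.+1) = (s q + dimension (@bdry I' p q.+1))%N.
  move=> p; have /choice[s sP] := dim_bdry_step p.
  by exists s => q; have [] := sP q.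
have hs p q := (sP p q).1; have sE p q := (sP p q).2.
have s_le p q : (s p q <= dimension (@cyc I p q))%N.
  exact: fdim_le (@bdry_colon_cyc p q) (hs p q) (fdim_cyc I p q).
have s_ge p q : (dimension (@bdry I p q) <= s p q)%N.
  exact: fdim_le (@bdry_in_colon p q) (fdim_bdry I p q) (hs p q).
exists (fun p q => dimension (@cyc I p q) - s p q)%N; split.
- move=> p q.
  have := dim_chain_step p.+1 q; rewrite !dim_chainE.
  have := sE p q; have := sE p.+1 q.
  have := hdimE I p.+1 q.+1; have := hdimE I p q.
  have := hdimE I' p.+1 q.+1; have := hdimE I p.+1 q.
  have := s_le p q; have := s_le p.+1 q.
  by lia.
- move=> q; have c0 J q' : dimension (@chain J 0 q') = dimension (@cyc J 0 q') by [].
  have := dim_chain_step 0 q; rewrite !c0.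
  have := sE 0%N q; have := s_le 0%N q.
  have := hdimE I 0 q.+1; have := hdimE I' 0 q.+1; have := hdimE I 0 q.
  by lia.
- by move=> p q; have := hdimE I p q; have := s_ge p q; lia.
- move=> p q h0; apply/eqP; rewrite subn_eq0.
  apply: (fdim_le _ (fdim_cyc I p q) (hs p q)) => v vZ.
  split; first exact: cyc_chain.
  have := hdimE I p q.+1; rewrite h0 add0n => bz.
  have hb := fdim_bdry I p q.+1; rewrite bz in hb.
  apply: (fdim_eq (@bdry_cyc I p q.+1) hb (fdim_cyc I p q.+1)).
  case: p v vZ {h0 bz hb} => [|p] v /=; first exact: chain_mulX.
  by move=> [vC dv]; split; [exact: chain_mulX|rewrite dif_mulX dv linear0].
Qed.

End Step.

End Chains.

(** * The Veronese ideal and its linear sections *)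

Section Veronese.
Variables (F : fieldType) (n : nat).
Local Notation S := {mpoly F[n.+1]}.
Local Notation ver := (@veronese_ideal F n).
Implicit Types (m : 'X_{1..n.+1}) (I : {set 'I_n.+1}) (f g : S).

(** The monomial m of degree q maps to u_0^(n q - k) u_1^k with k the weight
    of m, so degree and weight determine it modulo the ideal of the curve. *)
Definition weight m := (\sum_i m i * i)%N.

Lemma weightD m1 m2 : weight (m1 + m2)%MM = (weight m1 + weight m2)%N.
Proof.
by rewrite /weight -big_split; apply: eq_bigr => i _; rewrite mnmDE mulnDl.
Qed.

Lemma weight0 : weight 0%MM = 0%N.
Proof. by rewrite /weight big1 // => i _; rewrite mnm0E. Qed.

Lemma weightU i : weight U_(i)%MM = i.
Proof.
rewrite /weight (bigD1 i) //= mnm1E eqxx mul1n big1 ?addn0 // => j /negPf ji.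
by rewrite mnm1E eq_sym ji.
Qed.

Lemma weightMn m k : weight (m *+ k)%MM = (weight m * k)%N.
Proof.
by elim: k => [|k IH]; rewrite ?mulm0n ?weight0 ?muln0 // mulmS weightD IH mulnS.
Qed.

Lemma weight_le m : (weight m <= n * mdeg m)%N.
Proof.
rewrite /weight mdegE mulnC big_distrl /=; apply: leq_sum => i _.
by rewrite leq_mul2l -ltnS ltn_ord orbT.
Qed.

Lemma ver_gen (i j k l : 'I_n.+1) : (i + j = k + l)%N ->
  'X_i * 'X_j - 'X_k * 'X_l \in ver.
Proof.
move=> e; apply/asboolP.
exists (fun a b c d => ((a == i) && (b == j) && (c == k) && (d == l))%:R).
rewrite (bigD1 i) //= [X in _ = _ + X]big1 => [|a /negPf ai]; last first.
  by do 3!(rewrite big1 // => ? _); rewrite ai mul0r.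
rewrite addr0 (bigD1 j) //= [X in _ = _ + X]big1 => [|b /negPf bj]; last first.
  by do 2!(rewrite big1 // => ? _); rewrite bj andbF mul0r.
rewrite addr0 (bigD1 k) //= [X in _ = _ + X]big1 => [|c /negPf ck]; last first.
  by rewrite big1 // => ? _; rewrite ck andbF mul0r.
rewrite addr0 (bigD1 l) ?e //= [X in _ = _ + X]big1 => [|d /andP[_ /negPf dl]].
  by rewrite !eqxx mul1r addr0.
by rewrite dl andbF mul0r.
Qed.

Definition mono_congr m1 m2 := 'X_[m1] - 'X_[m2] \in ver.

Lemma mono_congr_refl m : mono_congr m m.
Proof. by rewrite /mono_congr subrr rpred0. Qed.

Lemma mono_congr_trans m2 m1 m3 :
  mono_congr m1 m2 -> mono_congr m2 m3 -> mono_congr m1 m3.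
Proof. by move=> h1 h2; rewrite /mono_congr -(subrKA 'X_[m2]) rpredD. Qed.

Lemma mono_congr_add a m1 m2 : mono_congr m1 m2 -> mono_congr (a + m1)%MM (a + m2)%MM.
Proof. by move=> h; rewrite /mono_congr !mpolyXD -mulrBr idealMr. Qed.

Lemma mono_congr_swap (i j k l : 'I_n.+1) m : (i + j = k + l)%N ->
  mono_congr (U_(i) + (U_(j) + m))%MM (U_(k) + (U_(l) + m))%MM.
Proof.
move=> e; rewrite !addmA ![(_ + m)%MM]addmC; apply: mono_congr_add.
by rewrite /mono_congr !mpolyXD ver_gen.
Qed.

(** The monomial of degree q and weight k with at most one variable other than
    x_0 and x_n; meaningful for k <= n q. *)
Fixpoint normal_mono q k : 'X_{1..n.+1} :=
  if q is q'.+1 then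
    if (k <= n * q')%N then (U_(ord0) + normal_mono q' k)%MM
    else (U_(inord (k - n * q')) + U_(ord_max) *+ q')%MM
  else 0%MM.

Lemma mdeg_normal_mono q k : mdeg (normal_mono q k) = q.
Proof.
elim: q => [|q IH] /=; first by rewrite mdeg0.
by case: ifP => _; rewrite mdegD ?IH ?mdegMn !mdeg1 ?mul1n.
Qed.

Lemma weight_normal_mono q k : (k <= n * q)%N -> weight (normal_mono q k) = k.
Proof.
elim: q => [|q IH] /=; first by rewrite muln0 leqn0 weight0 => /eqP.
rewrite mulnS => kq; case: ifP => kn; first by rewrite weightD weightU IH.
by rewrite weightD weightMn !weightU /= inordK; lia.
Qed.

(** Induction on the degree: a monomial is x_a times one of lower degree,
    already in normal form x_0 ... or x_b x_n^d. In the first case x_0 can be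
    set apart; in the second the quadric relation replaces x_a x_b by
    x_0 x_(a+b) or by x_(a+b-n) x_n. *)
Lemma mono_congr_normal m : mono_congr m (normal_mono (mdeg m) (weight m)).
Proof.
move dE: (mdeg m) => d; elim: d m dE => [|d IHd] m dE.
  by move/eqP: dE; rewrite mdeg_eq0 => /eqP->; apply: mono_congr_refl.
have [a ma] : exists a, m a != 0%N.
  apply/existsP; apply: contra_eqT dE; rewrite negb_exists => /forallP m0.
  by rewrite mdegE big1 // => i _; have := m0 i; rewrite negbK => /eqP.
have {ma} := ma; rewrite -lep1mP => /submK; set m1 := (m - _)%MM => mE.
rewrite addmC in mE; rewrite -mE.
have {dE mE} d1 : mdeg m1 = d by move: dE; rewrite -mE mdegD mdeg1 => -[].
have := mono_congr_add U_(a)%MM (IHd _ d1) => /mono_congr_trans; apply.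
have: (weight m1 <= n * d)%N by rewrite -d1; apply: weight_le.
rewrite weightD weightU; move: (weight m1) => {m m1 d1} k kd.
have /= IH0 m' : mdeg m' = d -> (weight m' <= n * d)%N ->
    mono_congr (U_(ord0) + m')%MM (normal_mono d.+1 (weight m')).
  by move=> md' wd; rewrite /= wd; apply/mono_congr_add/IHd.
have an : (a <= n)%N by rewrite -ltnS.
(* In degree 1 every monomial is normal. *)
have [d0|d0] := posnP d.
  move: kd; rewrite d0 muln0 leqn0 => /eqP->; rewrite /= ?muln0 addn0.
  case: ifP => a0; last by rewrite subn0 inord_val mulm0n; apply: mono_congr_refl.
  rewrite (_ : a = ord0); first exact: mono_congr_refl.
  by apply/val_inj => /=; lia.
case: d d0 kd IHd IH0 => // d _ kd IHd IH0; rewrite [normal_mono _.+1 k]/=.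
case: ifP => kd'.
  rewrite addmA (addmC U_(a)%MM) -addmA.
  have -> : (a + k = weight (U_(a) + normal_mono d k)%MM)%N.
    by rewrite weightD weightU weight_normal_mono.
  apply: IH0; rewrite ?mdegD ?mdeg1 ?mdeg_normal_mono //.
  by rewrite weightD weightU weight_normal_mono //; lia.
set b : 'I_n.+1 := inord _; have bE : b = (k - n * d)%N :> nat.
  by rewrite inordK //; lia.
have [ab|ab] := leqP (a + b)%N n.
  have ab' : (a + b < n.+1)%N by [].
  apply: (@mono_congr_trans (U_(ord0) + (U_(Ordinal ab') + U_(ord_max) *+ d))%MM).
    by apply: mono_congr_swap.
  have -> : (a + k = weight (U_(Ordinal ab') + U_(ord_max) *+ d)%MM)%N.
    by rewrite weightD weightMn !weightU /=; lia.
  apply: IH0; first by rewrite mdegD mdegMn !mdeg1; lia.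
  by rewrite weightD weightMn !weightU /=; lia.
rewrite ifF; last by lia.
rewrite mulmS; apply: mono_congr_swap; rewrite /= inordK; lia.
Qed.

(** The coefficient of u_0^(n q - k) u_1^k in the image of the degree q part of
    f. *)
Definition weight_coef q k f : F :=
  (mfilter (fun m => (mdeg m == q) && (weight m == k)) f).@[fun=> 1].

Lemma weight_coef_is_linear q k : linear_for *%R (weight_coef q k).
Proof. by move=> a f g; rewrite /weight_coef linearP mevalD mevalZ. Qed.
HB.instance Definition _ q k :=
  GRing.isLinear.Build F S F *%R (weight_coef q k) (@weight_coef_is_linear q k).

Lemma weight_coefX q k m : weight_coef q k 'X_[m] = ((mdeg m == q) && (weight m == k))%:R.
Proof.
rewrite /weight_coef mfilterX; case: ifP => _; last by rewrite meval0.
by rewrite mevalX big1 // => i _; rewrite expr1n.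
Qed.

Lemma weight_coef_ext q k g : (forall m, weight_coef q k ('X_[m] * g) = 0) ->
  forall f, weight_coef q k (f * g) = 0.
Proof.
move=> h f; rewrite (mpolyE f) mulr_suml linear_sum big1 // => m _.
by rewrite -scalerAl linearZ /= h mulr0.
Qed.

Lemma weight_coef_ver q k f : f \in ver -> weight_coef q k f = 0.
Proof.
move=> /asboolP[c ->].
rewrite linear_sum big1 // => i _; rewrite linear_sum big1 // => j _.
rewrite linear_sum big1 // => a _; rewrite linear_sum big1 // => b /eqP e.
apply: weight_coef_ext => m; rewrite mulrBr linearB /= -!mpolyXD.
rewrite !weight_coefX !mdegD !weightD !mdeg1.
by rewrite !weightU e subrr.
Qed.

(** The weights of the degree q monomials divisible by a variable of I: those of
    x_i m, where m ranges over the monomials of degree q - 1, whose weights fill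
    the interval from 0 to n (q - 1). *)
Definition killed I q k :=
  [exists i in I, (0 < q)%N && (i <= k <= n * q.-1 + i)%N].

(** f is a combination of multiples of the variables of I, and no such multiple
    has weight k. *)
Lemma weight_coef_nonfree I q k f g : ~~ killed I q k ->
  mfilter (free_of I) f = 0 -> weight_coef q k (f * g) = 0.
Proof.
move=> nk f0; rewrite mulrC; apply: weight_coef_ext => a.
rewrite (mpolyE f) mulr_sumr linear_sum big_seq big1 //= => m mf.
rewrite -scalerAr linearZ /= -mpolyXD weight_coefX.
have : ~~ free_of I m.
  apply/negP => mI; move: mf; rewrite mcoeff_msupp.
  by have := congr1 (mcoeff m) f0; rewrite mcoeff_mfilter mI mcoeff0 => ->; rewrite eqxx.
rewrite negb_forall_in => /exists_inP[i iI]; rewrite -lep1mP => /submK.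
set m1 := (m - _)%MM => mE.
case E: (_ && _); last by rewrite mulr0.
case/andP: E => /eqP mq /eqP mk; case/exists_inPn/(_ i iI)/negP: nk.
move: mq mk; rewrite -mE addmA mdegD weightD weightU mdeg1.
by have := weight_le (a + m1); lia.
Qed.

(** Membership in the ideal generated by the quadrics of the curve and the
    variables of I. *)
Definition in_section_ideal I f := exists w : 'I_n.+1 -> S,
  f - \sum_(i in I) 'X_i * w i \in ver.

Lemma in_section_ideal_lin I (a : F) f g :
  in_section_ideal I f -> in_section_ideal I g ->
  in_section_ideal I (a *: f + g).
Proof.
move=> [u fu] [v gv]; exists (fun i => a *: u i + v i).
under eq_bigr => i _ do rewrite mulrDr -scalerAr.
rewrite big_split -scaler_sumr /= opprD addrACA -scalerBr.
by rewrite rpredD // -mul_mpolyC idealMr.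
Qed.

Lemma in_section_ideal0 I : in_section_ideal I 0.
Proof. by exists (fun=> 0); rewrite big1 ?subrr ?rpred0 // => i _; rewrite mulr0. Qed.

Lemma in_section_ideal_sum I (T : Type) (r : seq T) (P : pred T)
    (c : T -> F) (h : T -> S) :
  (forall t, P t -> in_section_ideal I (h t)) ->
  in_section_ideal I (\sum_(t <- r | P t) c t *: h t).
Proof.
move=> hJ; elim: r => [|t r IH]; first by rewrite big_nil; apply: in_section_ideal0.
by rewrite big_cons; case: ifP => // Pt; apply: in_section_ideal_lin => //; apply: hJ.
Qed.

Lemma in_section_ideal_killed I q k :
  killed I q k -> in_section_ideal I 'X_[normal_mono q k].
Proof.
move=> /exists_inP[i iI /andP[q0 /andP[ik kn]]].
have kE : (weight (U_(i) + normal_mono q.-1 (k - i))%MM = k)%N.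
  by rewrite weightD weightU weight_normal_mono; lia.
have qE : mdeg (U_(i) + normal_mono q.-1 (k - i))%MM = q.
  by rewrite mdegD mdeg1 mdeg_normal_mono; lia.
exists (fun j => if j == i then 'X_[normal_mono q.-1 (k - i)] else 0).
rewrite (bigD1 i) //= eqxx big1 ?addr0; last first.
  by move=> j /andP[_ /negPf->]; rewrite mulr0.
rewrite -mpolyXD -opprB rpredN.
by have := mono_congr_normal (U_(i) + normal_mono q.-1 (k - i))%MM; rewrite kE qE.
Qed.

(** Modulo the quadrics f is the combination of the normal monomials with
    coefficients [weight_coef]; those of killed weight lie in the ideal. *)
Lemma in_section_idealP I q f : {in msupp f, forall m, mdeg m = q} ->
  (forall k, (k <= n * q)%N -> ~~ killed I q k -> weight_coef q k f = 0) ->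
  in_section_ideal I f.
Proof.
move=> fq f0.
have fE : f =
    1 *: (\sum_(m <- msupp f) f@_m *: ('X_[m] - 'X_[normal_mono q (weight m)])) +
    \sum_(k < (n * q).+1) weight_coef q k f *: 'X_[normal_mono q k].
  have -> : \sum_(k < (n * q).+1) weight_coef q k f *: 'X_[normal_mono q k] =
      \sum_(m <- msupp f) f@_m *: 'X_[normal_mono q (weight m)] :> S; last first.
    under eq_bigr => m _ do rewrite scalerBr.
    by rewrite scale1r sumrB -mpolyE subrK.
  under eq_bigr => k _ do rewrite {1}(mpolyE f) linear_sum scaler_suml.
  rewrite exchange_big /= big_seq [RHS]big_seq; apply: eq_bigr => m mf.
  have kq : (weight m < (n * q).+1)%N by rewrite ltnS -(fq m mf) weight_le.
  rewrite (bigD1 (Ordinal kq)) //= linearZ /= weight_coefX (fq m mf) !eqxx mulr1.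
  rewrite big1 ?addr0 // => k /eqP km; rewrite linearZ /= weight_coefX.
  rewrite (fq m mf) eqxx /=; case: eqP => [kE|]; last by rewrite mulr0 scale0r.
  by case: km; apply: val_inj.
rewrite fE; apply: in_section_ideal_lin.
  rewrite big_seq; apply: in_section_ideal_sum => m mf; exists (fun=> 0).
  rewrite big1 ?subr0 => [|i _]; last by rewrite mulr0.
  by rewrite -(fq m mf); apply: mono_congr_normal.
rewrite (bigID (fun k : 'I__ => killed I q k)) /= addrC big1 ?add0r.
  by apply: in_section_ideal_sum => k; apply: in_section_ideal_killed.
by move=> k nk; rewrite f0 ?scale0r // -ltnS.
Qed.

End Veronese.

(** * Free resolutions and Tor *)

Section Resolution.
Variables (F : fieldType) (n : nat) (A : comNzRingType).
Local Notation S := {mpoly F[n]}.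
Variables (f : {rmorphism S -> A}) (G : graded_resolution f).
Local Notation rk := (gr_rank G).
Local Notation dg := (@gr_deg _ _ _ _ G).
Local Notation D := (gr_diff G).
Local Notation M p := {ffun 'I_(rk p) -> S}.

Lemma gr_diffK p : D p.+1 *m D p = 0.
Proof.
apply/row_matrixP => i; rewrite row_mul row0; apply/gr_exactS.
by exists (delta_mx 0 i); rewrite -rowE.
Qed.

Lemma ffun_mulmx p (w : M p.+1) :
  \row_j dif D set0 w j = (\row_i w i) *m D p.
Proof.
apply/rowP => j; rewrite !mxE ffunE; apply: eq_bigr => i _; rewrite mxE.
by congr (_ * _); apply/mfilter_idP/allP => m _; apply: free_of0.
Qed.

Lemma kill0 p (v : M p) : kill set0 v = v.
Proof.
apply/ffunP => j; rewrite ffunE; apply/mfilter_idP/allP => m _.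
exact: free_of0.
Qed.

Lemma resolution_acyclic p q : hdim dg D set0 p.+1 q = 0%N.
Proof.
apply/eqP; rewrite subn_eq0.
have hc := fdim_cyc dg D set0 p.+1 q.
have hb := fdim_bdry (@gr_diff_homog _ _ _ _ G) gr_diffK set0 p.+1 q.
apply: fdim_le hc hb.
move=> v [[hv kv] dv].
have [|w wE] := (gr_exactS (\row_j v j)).1.
  by rewrite -ffun_mulmx dv; apply/rowP => j; rewrite !mxE ffunE.
have vE : v = dif D set0 [ffun j => w 0 j].
  apply/ffunP => j; have := congr1 (fun r : 'rV__ => r 0 j) wE.
  rewrite mxE => ->; have := congr1 (fun r : 'rV__ => r 0 j)
    (ffun_mulmx [ffun j => w 0 j]).
  rewrite mxE => ->; congr ((_ *m _) _ _); apply/rowP => i.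
  by rewrite !mxE ffunE.
exists (hpart dg q [ffun j => w 0 j]).
  by split; rewrite ?hpart_id ?kill0.
by rewrite -(hpart_dif (@gr_diff_homog _ _ _ _ G)) -vE hv.
Qed.

Definition cst p (x : 'rV[F]_(rk p)) : M p := [ffun j => (x 0 j)%:MP].

Lemma cst_is_linear p : linear (@cst p).
Proof.
move=> a x y; apply/ffunP => j; rewrite !ffunE !mxE.
by rewrite mpolyCD mpolyCM mul_mpolyC.
Qed.
HB.instance Definition _ p :=
  GRing.isLinear.Build F 'rV[F]_(rk p) (M p) *:%R (@cst p) (@cst_is_linear p).

Lemma cst_eq0 p (x : 'rV[F]_(rk p)) : cst x = 0 -> x = 0.
Proof.
move=> /ffunP c0; apply/rowP => j; have := c0 j; rewrite !ffunE mxE.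
by move=> /eqP; rewrite mpolyC_eq0 => /eqP.
Qed.

Lemma free_ofT (m : 'X_{1..n}) : free_of setT m = (m == 0%MM).
Proof.
apply/forall_inP/eqP => [h|-> i _]; last by rewrite mnm0E.
by apply/mnmP => i; rewrite mnm0E; apply/eqP/h; rewrite inE.
Qed.

Lemma mfilter_freeT (g : S) : mfilter (free_of setT) g = (g@_0%MM)%:MP.
Proof.
apply/mpolyP => m; rewrite mcoeff_mfilter free_ofT mcoeffC.
by rewrite eq_sym; case: eqP => [<-|]; rewrite ?mulr1 ?mulr0.
Qed.

(** With all variables killed, the chains are the constant vectors and [dif] is
    the differential tensored with the residue field. *)
Lemma dif_cst p (x : 'rV[F]_(rk p.+1)) :
  dif D setT (cst x) = cst (tensor_diff G p x).
Proof.
apply/ffunP => j; rewrite !ffunE lfunE /= mxE rmorph_sum /=.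
by apply: eq_bigr => i _; rewrite ffunE mfilter_freeT -mpolyCM mxE.
Qed.

Lemma mem_tensor_deg p q (x : 'rV[F]_(rk p)) :
  x \in tensor_deg G p q <-> forall j, gr_deg j != q -> x 0 j = 0.
Proof.
split=> [|x0].
  rewrite /tensor_deg; set s := [seq _ | _ <- _ & _] => xs j jq.
  rewrite (coord_span (X := in_tuple s) xs) summxE big1 // => i _; rewrite mxE.
  have : s`_i \in s by rewrite mem_nth.
  move=> /mapP[k]; rewrite mem_filter => /andP[kq _] ->.
  by rewrite mxE (_ : (j == k) = false) ?andbF ?mulr0 //; apply: contraNF jq => /eqP->.
rewrite (row_sum_delta x); apply: memv_suml => j _.
have [jq|/x0->] := eqVneq (gr_deg j) q; last by rewrite scale0r mem0v.
apply/memvZ/memv_span/mapP; exists j => //.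
by rewrite mem_filter jq eqxx mem_enum.
Qed.

Lemma chain_cst p q (v : M p) : chain dg setT q v <->
  exists2 x, x \in tensor_deg G p q & v = cst x.
Proof.
split=> [vC|[x /mem_tensor_deg xq ->]].
  have vE : v = cst (\row_j (v j)@_0%MM).
    have [_ {1}<-] := vC; apply/ffunP => j.
    by rewrite !ffunE mfilter_freeT mxE.
  exists (\row_j (v j)@_0%MM) => //; apply/mem_tensor_deg => j jq.
  rewrite mxE; apply: memN_msupp_eq0; apply: contra_neqN jq => m0.
  by have /chainP/(_ _ _ m0)[<- _] := vC; rewrite mdeg0.
apply/chainP => j m; rewrite ffunE mcoeff_msupp mcoeffC mulr_natr.
rewrite free_ofT; case: (m =P 0%MM) => [->|]; rewrite ?mulr1n ?eqxx //.
by move=> xj; split=> //; rewrite mdeg0; apply/eqP; apply: contraNT xj => /xq->.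
Qed.

Lemma fdim_tor_cycles p q :
  fdim (@cyc _ _ _ dg D setT p q) (\dim (tor_cycles G p q)).
Proof.
apply: fdim_ext (fdim_vspace (psi := @cst p) (U := tor_cycles G p q) _);
  last by move=> x _; apply: cst_eq0.
move=> v; case: p v => [|p] v /=.
  by have [h1 h2] := chain_cst q v; split.
split=> [[x]|[/chain_cst[x xq ->] dx]].
  rewrite memv_cap memv_ker => /andP[xq /eqP dx] ->.
  by split; [apply/chain_cst; exists x|rewrite dif_cst dx linear0].
exists x => //; rewrite memv_cap xq memv_ker.
by move: dx; rewrite dif_cst => /cst_eq0->; rewrite eqxx.
Qed.

Lemma fdim_tor_boundaries p q :
  fdim (@bdry _ _ _ dg D setT p q) (\dim (tor_boundaries G p q)).
Proof.
apply: fdim_ext (fdim_vspace (psi := @cst p) (U := tor_boundaries G p q) _);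
  last by move=> x _; apply: cst_eq0.
move=> v; split=> [[_ /memv_imgP[x xq ->] ->]|[_ /chain_cst[x xq ->] ->]].
  by exists (cst x); [apply/chain_cst; exists x|rewrite dif_cst].
by exists (tensor_diff G p x); [apply: memv_img|rewrite dif_cst].
Qed.

Lemma dim_tor p q : \dim (fullv : {vspace tor G p q}) = hdim dg D setT p q.
Proof.
have hD := @gr_diff_homog _ _ _ _ G.
rewrite dimvf /tor /dim /= /hdim (dimensionE (fdim_tor_cycles p q)).
rewrite (dimensionE (fdim_tor_boundaries p q)).
set Z := tor_cycles _ _ _; set B := tor_boundaries _ _ _.
have BZ : (B <= Z)%VS.
  apply/subvP => x xB.
  have : @bdry _ _ _ dg D setT p q (cst x).
    have /memv_imgP[y yq ->] := xB.
    by exists (cst y); [apply/chain_cst; exists y|rewrite dif_cst].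
  move=> /(bdry_cyc hD gr_diffK); rewrite /Z; clear B Z xB.
  case: p x => [|p] x /=.
    by move=> /chain_cst[y yq /eqP]; rewrite -subr_eq0 -linearB => /eqP
      /cst_eq0/eqP; rewrite subr_eq0 => /eqP->.
  move=> [/chain_cst[y yq /eqP]]; rewrite -subr_eq0 -linearB => /eqP/cst_eq0.
  move=> /eqP; rewrite subr_eq0 => /eqP-> dy.
  by rewrite memv_cap yq memv_ker; move: dy; rewrite dif_cst => /cst_eq0->; rewrite eqxx.
have := dimv_cap_compl Z B; rewrite (capv_idPr BZ) => <-.
by rewrite addKn.
Qed.

End Resolution.

(** * Degree zero homology of the sections *)

Section VeroneseH0.
Variables (F : fieldType) (n : nat).
Local Notation S := {mpoly F[n.+1]}.
Local Notation pr := (veronese_proj F n).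
Variable G : graded_resolution pr.
Local Notation rk := (gr_rank G).
Local Notation dg := (@gr_deg _ _ _ _ G).
Local Notation D := (gr_diff G).
Local Notation M p := {ffun 'I_(rk p) -> S}.
Implicit Types (I : {set 'I_n.+1}).

Lemma veronese_proj_eq0 (f : S) : pr f = 0 <-> f \in @veronese_ideal F n.
Proof.
have := Quotient.idealrBE (@veronese_ideal F n) f 0; rewrite subr0 => ->.
rewrite -(rmorph0 pr); split => [e|/eqP e]; last by [].
by apply/eqP.
Qed.

Definition surviving I q := [pred k : 'I_(n * q).+1 | ~~ killed I q k].

Lemma weight_coef_hpart q k e (f s : S) : s \is e.-homog ->
  weight_coef q k (mfilter (fun m => mdeg m + e == q)%N f * s) = weight_coef q k (f * s).
Proof.
move=> /dhomogP sh; rewrite /weight_coef.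
have E (g : S) : mfilter (fun m => (mdeg m == q) && (weight m == k)) g =
    mfilter (fun m => weight m == k) (mfilter (fun m => mdeg m == q) g).
  by rewrite mfilter_comp; apply: eq_mfilter => m _; rewrite andbC.
rewrite !E; congr ((mfilter _ _).@[_]).
rewrite !(@mfilterM _ _ _ (fun m => mdeg m + e == q)%N xpredT).
- by rewrite mfilter_comp; congr (_ * _); apply: eq_mfilter => m _; rewrite andbb.
- by move=> m1 m2 _ /sh /= e2; rewrite mdegD e2 andbT.
- by move=> m1 m2 _ /sh /= e2; rewrite mdegD e2 andbT.
Qed.

Lemma weight_coef_kill I q k (f s : S) : ~~ killed I q k ->
  weight_coef q k (mfilter (free_of I) f * s) = weight_coef q k (f * s).
Proof.
move=> nk; apply/eqP; rewrite -subr_eq0 -linearB -mulrBl; apply/eqP.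
apply: weight_coef_nonfree nk _; rewrite linearB /= mfilter_comp; apply/eqP.
by rewrite subr_eq0; apply/eqP/eq_mfilter => m _; rewrite andbb.
Qed.

(** The linear map Psi of the proof sends a chain to the weight coefficients,
    for the surviving weights, of its image under the augmentation. Its kernel on the
    chains is the space of boundaries, by exactness of G, and it is onto because
    the normal monomials come from chains. *)
Lemma hdim_H0 I q : hdim dg D I 0 q = #|surviving I q|.
Proof.
have hD := @gr_diff_homog _ _ _ _ G.
have DD := @gr_diffK _ _ _ _ G.
have /choice[s sP] : forall j : 'I_(rk 0), exists s : S,
    s \is (gr_deg j).-homog /\ gr_aug j = pr s.
  by move=> j; have [s sh sE] := gr_aug_homog j; exists s.
have sh j := (sP j).1; have augE j := (sP j).2.
pose T (v : M 0) := \sum_j v j * s j.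
have T_lin : linear T.
  move=> a u v; rewrite /T scaler_sumr -big_split; apply: eq_bigr => j _.
  by rewrite !ffunE mulrDl scalerAl.
pose TL : {linear M 0 -> S} := HB.pack T
  (GRing.isLinear.Build _ _ _ _ T T_lin).
have TB u v : T (u - v) = T u - T v by exact: (linearB TL).
have Tsum I' (h : 'I_n.+1 -> M 0) : T (\sum_(i in I') h i) =
    \sum_(i in I' : {set _}) T (h i) by exact: (linear_sum TL).
have prT (v : M 0) : pr (T v) = \sum_j pr (v j) * gr_aug j.
  by rewrite rmorph_sum; apply: eq_bigr => j _; rewrite rmorphM augE.
have prT0 (v : M 0) :
    pr (T v) = 0 <-> exists w, v = dif D set0 w.
  rewrite prT; have := gr_exact0 (\row_j v j).
  under eq_bigr => j _ do rewrite mxE; move=> ->; split=> -[w].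
    move=> /rowP wE; exists [ffun i => w 0 i]; apply/ffunP => j.
    have := wE j; rewrite mxE => ->.
    have /rowP/(_ j) := ffun_mulmx [ffun i => w 0 i]; rewrite mxE => ->.
    by congr ((_ *m _) _ _); apply/rowP => i; rewrite !mxE ffunE.
  by move=> ->; exists (\row_i w i); rewrite ffun_mulmx.
have prS (g : S) : exists y : M 0, pr g = pr (T y).
  have [v ->] := gr_aug_surj G (pr g); exists [ffun j => v 0 j].
  by rewrite prT; apply: eq_bigr => j _; rewrite ffunE.
pose a := #|surviving I q|.
pose Psi (v : M 0) : 'rV[F]_a :=
  \row_k weight_coef q (enum_val k : 'I_(n * q).+1) (T v).
have Psi_lin : linear Psi.
  by move=> c u v; apply/rowP => k; rewrite !mxE T_lin linearP.
pose PsiL : {linear M 0 -> 'rV[F]_a} := HB.pack Psi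
  (GRing.isLinear.Build _ _ _ _ Psi Psi_lin).
have T_hpart k (v : M 0) : weight_coef q k (T (hpart dg q v)) = weight_coef q k (T v).
  rewrite /T !linear_sum; apply: eq_bigr => j _; rewrite ffunE.
  exact: weight_coef_hpart.
have T_kill k (v : M 0) : ~~ killed I q k ->
    weight_coef q k (T (kill I v)) = weight_coef q k (T v).
  move=> nk; rewrite /T !linear_sum; apply: eq_bigr => j _; rewrite ffunE.
  exact: weight_coef_kill.
have Psi_bdry v : chain dg I q v -> Psi v = 0 <-> bdry dg D I q v.
  move=> vC; have [hv kv] := vC; split=> [Psi0|[w [_ kw] vE]]; last first.
    apply/rowP => k; rewrite !mxE.
    have -> : v = kill I (dif D set0 w) by rewrite kill_dif set0U kw.
    rewrite T_kill; last exact: (enum_valP k).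
    by apply/weight_coef_ver/veronese_proj_eq0/prT0; exists w.
  have [||g /veronese_proj_eq0] := @in_section_idealP F n I q (T v).
  - move=> m; rewrite /T => /msupp_sum_le /flatten_mapP[j _ /msuppM_le].
    move=> /allpairsP[[m1 m2] /= [m1v m2s ->]]; rewrite mdegD.
    by have /chainP/(_ _ _ m1v)[<- _] := vC; have /dhomogP/(_ _ m2s) /= -> := sh j.
  - move=> k kq nk; have kq' : (k < (n * q).+1)%N by [].
    have kI : Ordinal kq' \in surviving I q by [].
    have /rowP/(_ (enum_rank_in kI (Ordinal kq'))) := Psi0.
    by rewrite !mxE enum_rankK_in.
  have /choice[y yE] := fun i => prS (g i).
  have -> : pr (T v - \sum_(i in I) 'X_i * g i) =
            pr (T (v - \sum_(i in I) mulX i (y i))).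
    rewrite TB !rmorphB; congr (_ - _).
    rewrite Tsum !rmorph_sum; apply: eq_bigr => i _ /=.
    rewrite rmorphM yE -rmorphM; apply: (congr1 pr).
    by rewrite /T mulr_sumr; apply: eq_bigr => j _; rewrite ffunE mulrA.
  move=> /prT0[w vE]; exists (hpart dg q (kill I w)).
    by split; rewrite ?hpart_id // kill_hpart kill_kill setUid.
  rewrite -hpart_dif // -[I in dif D I]set0U -kill_dif -vE linearB /= kv.
  rewrite linear_sum big1 ?subr0 ?hv // => i iI.
  apply/ffunP => j; rewrite !ffunE mfilter_freeM mfilterX ifF ?mul0r //.
  by apply/negP => /forall_inP/(_ i iI); rewrite mnm1E eqxx.
have Psi_surj x : exists2 v, chain dg I q v & x = Psi v.
  have [y yE] := prS (\sum_k x 0 k *: 'X_[normal_mono n q (enum_val k : 'I_(n * q).+1)]).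
  exists (hpart dg q (kill I y)).
    by split; rewrite ?hpart_id // kill_hpart kill_kill setUid.
  apply/rowP => k; rewrite mxE T_hpart T_kill; last exact: (enum_valP k).
  have /eqP := yE; rewrite -subr_eq0 -rmorphB => /eqP/veronese_proj_eq0/weight_coef_ver.
  move=> /(_ q (enum_val k : 'I__)); rewrite linearB /= => /eqP; rewrite subr_eq0.
  move=> /eqP <-; rewrite linear_sum (bigD1 k) //= big1 ?addr0.
    rewrite linearZ /= weight_coefX mdeg_normal_mono weight_normal_mono ?eqxx ?mulr1 //.
    by rewrite -ltnS.
  move=> l lk; rewrite linearZ /= weight_coefX mdeg_normal_mono.
  rewrite weight_normal_mono -1?ltnS // eqxx /=.
  by rewrite (inj_eq val_inj) (inj_eq enum_val_inj) (negPf lk) mulr0.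
have hc := fdim_cyc dg D I 0 q.
have [k [r [hE hk hr]]] := fdim_rank_nullity PsiL hc.
rewrite /hdim hE (dimensionE (d := k)); last first.
  apply: fdim_ext hk => v; split=> [[vC /(Psi_bdry _ vC)]//|vB].
  have vC := bdry_cyc hD DD vB; split=> //.
  exact/(Psi_bdry _ vC).
rewrite addKn; apply: (fdim_uniq hr).
exists (idfun : {linear 'rV[F]_a -> 'rV[F]_a}) => // x.
by split=> _; [exists x|apply: Psi_surj].
Qed.

End VeroneseH0.

(** * Betti numbers *)

Lemma card_ord_range N a b (P : pred 'I_N) : (b <= N)%N ->
  (forall k : 'I_N, P k = (a <= k < b)%N) -> #|P| = (b - a)%N.
Proof.
move=> bN PE; transitivity (\sum_(a <= k < b) 1)%N; last first.
  by rewrite sum_nat_const_nat muln1.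
rewrite big_geq_mkord (big_ord_widen_cond N (fun k => a <= k)%N (fun=> 1%N) bN).
by rewrite -sum1_card; apply: eq_bigl => k; rewrite -PE.
Qed.

(** The left side is dim pi_[2,1^(p-1)] plus dim Lambda^(p+1) and the right side
    dim (W tensor Lambda^p), with dim W = m. *)
Lemma hook_bin m p :
  (p * 'C(m.+1, p.+1) + 'C(m, p.+1) = m * 'C(m, p))%N.
Proof.
rewrite binS mulnDr addnAC -mulSnr mul_bin_left -mulnDl.
have [pm|mp] := leqP p m; first by rewrite subnK.
by rewrite bin_small // !muln0.
Qed.

Section Numbers.
Variables (F : fieldType) (n : nat).
Hypothesis n_gt0 : (0 < n)%N.
Variable G : graded_resolution (veronese_proj F n).
Local Notation hD := (@gr_diff_homog _ _ _ _ G).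
Local Notation DD := (@gr_diffK _ _ _ _ G).
Local Notation h := (hdim (@gr_deg _ _ _ _ G) (gr_diff G)).
Implicit Types (I : {set 'I_n.+1}).

Lemma killedS I q k :
  killed I q.+1 k = [exists i in I, (i <= k <= n * q + i)%N].
Proof. by []. Qed.

Lemma killed0 I k : killed I 0 k = false.
Proof. by apply/exists_inPn. Qed.

Lemma hdim_H0_0 I : h I 0 0 = 1%N.
Proof.
rewrite hdim_H0 (@card_ord_range _ 0 1) ?muln0 // => k.
by rewrite inE /= killed0 /=; case: k => k /=; rewrite muln0 => ->.
Qed.

(** The order of killing is x_0, x_n, x_1, ..., x_(n-1): first a regular
    sequence, then the variables of the Artinian algebra F + W, with W spanned by
    x_1, ..., x_(n-1) and W^2 = 0. *)
Definition cut_vars t := [set i : 'I_n.+1 | (i <= t)%N || (i == n :> nat)].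

Lemma cut_vars0 : cut_vars 0 = ord_max |: (ord0 |: set0).
Proof.
apply/setP => i; rewrite !inE orbF leqn0 orbC.
by rewrite -!(inj_eq val_inj).
Qed.

Lemma cut_varsS t : (t.+1 < n)%N -> cut_vars t.+1 = inord t.+1 |: cut_vars t.
Proof.
move=> tn; apply/setP => i; rewrite !inE leq_eqVlt ltnS orbA.
by rewrite -(inj_eq val_inj) /= inordK // ltnS ltnW.
Qed.

Lemma cut_vars_notin t : (t.+1 < n)%N -> inord t.+1 \notin cut_vars t.
Proof.
by move=> tn; rewrite inE inordK; lia.
Qed.

Lemma cut_vars_full : cut_vars n.-1 = setT.
Proof. by apply/setP => i; rewrite !inE; have := ltn_ord i; lia. Qed.

Lemma hdim_H0_set0 q : h set0 0 q = (n * q).+1.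
Proof.
rewrite hdim_H0 (@card_ord_range _ 0 (n * q).+1) // => k; rewrite inE /=.
rewrite [LHS](_ : _ = true); first by have := ltn_ord k; lia.
by apply/exists_inPn => i; rewrite inE.
Qed.

Lemma hdim_H0_x0 q : h (ord0 |: set0) 0 q.+1 = n.
Proof.
rewrite hdim_H0 (@card_ord_range _ (n * q).+1 (n * q.+1).+1) //; first by lia.
move=> k; rewrite inE /= killedS; have kn := ltn_ord k.
have -> : [exists i in (ord0 : 'I_n.+1) |: set0, (i <= k <= n * q + i)%N] =
    (k <= n * q)%N.
  apply/exists_inP/idP => [[j]|kq].
    by rewrite !inE orbF => /eqP-> /=; lia.
  by exists ord0; rewrite ?setU11 //=; lia.
by lia.
Qed.

Lemma hdim_H0_cut1 t : (t < n)%N -> h (cut_vars t) 0 1 = (n - t.+1)%N.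
Proof.
move=> tn; rewrite hdim_H0 (@card_ord_range _ t.+1 n) ?muln1 // => k.
rewrite inE /= killedS; have kn := ltn_ord k.
have -> : [exists i in cut_vars t, (i <= k <= n * 0 + i)%N] =
    (k <= t)%N || (k == n :> nat).
  apply/exists_inP/idP => [[j]|kq].
    by rewrite !inE; lia.
  have kn' : (k < n.+1)%N by lia.
  by exists (Ordinal kn'); rewrite ?inE //=; lia.
by lia.
Qed.

Lemma hdim_H0_cut2 t q : h (cut_vars t) 0 q.+2 = 0%N.
Proof.
rewrite hdim_H0 (@card_ord_range _ 0 0) // => k.
rewrite inE /= killedS; have kn := ltn_ord k; apply/negbTE; rewrite negbK.
have [kq|kq] := leqP k (n * q.+1).
  by apply/exists_inP; exists ord0; rewrite ?inE //= addn0.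
apply/exists_inP; exists ord_max; rewrite ?inE ?eqxx ?orbT //=.
by lia.
Qed.

(** By the second hypothesis, a dimension count, x_i acts injectively on H_0;
    the long homology sequence then leaves nothing in positive degrees. *)
Lemma hdim_regular I (i : 'I_n.+1) : i \notin I ->
  (forall q, h (i |: I) 0 q.+1 + h I 0 q = h I 0 q.+1)%N ->
  (forall p q, h I p.+1 q = 0%N) -> forall p q, h (i |: I) p.+1 q = 0%N.
Proof.
move=> iI reg h0 p [|q]; first by rewrite (hdim_step0 hD DD) h0.
have [rho [r1 r2 r3 r4]] := hdim_step hD DD iI.
case: p => [|p]; last by have := r1 p.+1 q; rewrite !h0; lia.
by have := r1 0%N q; rewrite h0; have := reg q; have := r2 q; lia.
Qed.

Lemma hdim_cut0 p q : h (cut_vars 0) p.+1 q = 0%N.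
Proof.
rewrite cut_vars0; apply: hdim_regular => [|r|p' r].
- by rewrite !inE orbF -(inj_eq val_inj) /=; lia.
- rewrite -cut_vars0; case: r => [|r]; last by rewrite hdim_H0_cut2 !hdim_H0_x0.
  by rewrite hdim_H0_cut1 // hdim_H0_0 hdim_H0_x0; lia.
apply: hdim_regular => [|s|p2 s]; last exact: resolution_acyclic.
  by rewrite inE.
by rewrite hdim_H0_x0 !hdim_H0_set0; lia.
Qed.

(** The homology of the Koszul complex of F + W on t of its variables is
    the cokernel of Lambda^(p+1) F^t -> Lambda^p F^t tensor W in degree p + 1,
    which explains the formula; the proof is by recursion on t. The multiplication
    by the next variable is zero on homology except from degree 0 to degree 1
    on H_0, where it has rank 1. *)
Lemma hdim_cut t : (t < n)%N ->
  (forall p, (h (cut_vars t) p p.+1 + 'C(t, p.+1) = n.-1 * 'C(t, p))%N) /\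
  (forall p q, q != p.+1 -> (p != 0%N) || (q != 0%N) -> h (cut_vars t) p q = 0%N).
Proof.
elim: t => [_|t IH tn].
  split=> [[|p]|[|p] q]; rewrite ?hdim_cut0 ?hdim_H0_cut1 // ?bin0n; try lia.
  by case: q => [|[|q]] // _ _; apply: hdim_H0_cut2.
have [IH1 IH2] := IH (ltnW tn).
have [rho [r1 r2 r3 r4]] := hdim_step hD DD (cut_vars_notin tn).
rewrite -cut_varsS // in r1 r2.
split=> [[|p]|[|p] [|q]].
- by rewrite hdim_H0_cut1 // bin1 bin0; lia.
(* The target of one map and the source of the other vanish. *)
- have z1 : rho p p.+1 = 0%N by apply/r4/IH2; lia.
  have z2 : h (cut_vars t) p.+1 p.+1 = 0%N by apply: IH2; lia.
  have := r1 p p.+1; have := r3 p.+1 p.+1; rewrite z1 z2.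
  by have := IH1 p; have := IH1 p.+1; rewrite !binS; lia.
- by move=> _ /orP[].
- by case: q => // q _ _; apply: hdim_H0_cut2.
- by move=> _ _; rewrite cut_varsS // (hdim_step0 hD DD) IH2.
move=> qp _; have := r1 p q; have -> : h (cut_vars t) p.+1 q.+1 = 0%N by apply: IH2; lia.
have [/andP[/eqP p0 /eqP q0]|pq] := boolP ((p == 0) && (q == 0))%N; last first.
  by rewrite (IH2 p q); lia.
(* Here the multiplication from H_(0,0) to H_(0,1) is injective. *)
by have := r2 0%N; rewrite p0 q0 hdim_H0_0 !hdim_H0_cut1 // 1?ltnW //; lia.
Qed.

Lemma tor00 : \dim (fullv : {vspace tor G 0 0}) = 1%N.
Proof. by rewrite dim_tor hdim_H0_0. Qed.

Lemma tor_vanish p q : q != p.+1 -> (p != 0%N) || (q != 0%N) ->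
  \dim (fullv : {vspace tor G p q}) = 0%N.
Proof.
rewrite dim_tor -cut_vars_full; have [|_] := @hdim_cut n.-1; first by rewrite prednK.
by apply.
Qed.

Lemma dim_tor_linear p :
  \dim (fullv : {vspace tor G p p.+1}) = (p * 'C(n, p.+1))%N.
Proof.
rewrite dim_tor -cut_vars_full; have [|+ _] := @hdim_cut n.-1; first by rewrite prednK.
move=> /(_ p); have := hook_bin n.-1 p; rewrite prednK //; lia.
Qed.

End Numbers.

(** * Alternating functions *)

Section Alternating.
Variables (F : numFieldType) (m q : nat).
Local Notation X := {ffun 'I_q -> 'I_m}.
Implicit Types (u w : X) (s t : 'S_q) (f : X -> F).

Definition wperm w s : X := [ffun i => w (s i)].

Lemma wpermM w s t : wperm (wperm w s) t = wperm w (t * s)%g.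
Proof. by apply/ffunP => i; rewrite !ffunE permM. Qed.

Lemma wperm1 w : wperm w 1%g = w.
Proof. by apply/ffunP => i; rewrite ffunE perm1. Qed.

Lemma wperm_tpermK w k l : wperm (wperm w (tperm k l)) (tperm k l) = w.
Proof. by rewrite wpermM tperm2 wperm1. Qed.

Definition alternating f :=
  forall k l, k != l -> forall u, f (wperm u (tperm k l)) = - f u.

Lemma alternating_perm f s u : alternating f ->
  f (wperm u s) = (-1) ^+ s * f u.
Proof.
move=> fA; have [ts -> tsd] := prod_tpermP s.
elim: ts tsd => [_|[k l] ts IH /andP[kl /IH{}IH]] /=.
  by rewrite big_nil wperm1 odd_perm1 mul1r.
rewrite /dpair /= in kl.
rewrite big_cons -wpermM fA // IH odd_permM odd_tperm kl signr_addb expr1.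
by rewrite mulN1r mulNr.
Qed.

Lemma alternating_noninj f u k l : alternating f -> k != l -> u k = u l ->
  f u = 0.
Proof.
move=> fA kl ukl; have : f u = - f u.
  rewrite -(fA k l kl); congr f; apply/ffunP => i; rewrite ffunE.
  by case: tpermP => // ->.
by move/eqP; rewrite -addr_eq0 -mulr2n mulrn_eq0 /= => /eqP.
Qed.

Definition subsetq := {J : {set 'I_m} | #|J| == q}.

Definition enumJ (J : subsetq) : X :=
  [ffun l => enum_val (cast_ord (esym (eqP (valP J))) l)].

Lemma enumJ_in J l : enumJ J l \in val J.
Proof. by rewrite ffunE enum_valP. Qed.

Lemma enumJ_inj J : injective (enumJ J).
Proof.
by move=> k l; rewrite !ffunE => /enum_val_inj/cast_ord_inj.
Qed.

Lemma card_subsetq : #|{: subsetq}| = 'C(m, q).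
Proof.
rewrite card_sig -[in RHS](card_ord m) -(card_draws _ q).
by apply: eq_card => J; rewrite !inE.
Qed.

(** At an injective u, the value is up to sign that at the enumeration of the
    image of u; at other u it is 0 in characteristic 0. *)
Lemma alternating_eq0 f : alternating f ->
  (forall J, f (enumJ J) = 0) -> forall u, f u = 0.
Proof.
move=> fA f0 u; have [/injectiveP u_inj|] := boolP (injectiveb u); last first.
  by move=> /injectivePn[k [l kl ukl]]; apply: alternating_noninj fA kl ukl.
have cJ : #|[set u k | k in 'I_q]| == q by rewrite card_imset ?card_ord.
pose J : subsetq := exist (fun J : {set 'I_m} => #|J| == q) _ cJ.
have uJ k : u k \in val J by apply: imset_f.
pose s0 k := cast_ord (eqP cJ) (enum_rank_in (uJ k) (u k)).
have uE k : u k = enumJ J (s0 k).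
  rewrite ffunE /s0 /= cast_ord_comp cast_ord_id enum_rankK_in //; exact: uJ.
have s0_inj : injective s0.
  by move=> k l e; apply: u_inj; rewrite !uE e.
have -> : u = wperm (enumJ J) (perm s0_inj).
  by apply/ffunP => k; rewrite ffunE permE -uE.
by rewrite alternating_perm // f0 mulr0.
Qed.

(** These minors are the basis of the alternating functions dual to the
    evaluations at [enumJ]. *)
Definition minorJ (J : subsetq) u : F :=
  \det (\matrix_(k, l) ((u k == enumJ J l)%:R : F)).

Lemma det_alternating (g : 'M[F]_(m, q)) :
  alternating (fun u => \det (\matrix_(k, l) g (u k) l)).
Proof.
move=> k l kl u.
rewrite (_ : \matrix_(_, _) _ = row_perm (tperm k l)
    (\matrix_(a, b) g (u a) b)).
  by rewrite row_permE det_mulmx det_perm odd_tperm kl expr1 mulN1r.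
by apply/matrixP => a b; rewrite !mxE ffunE.
Qed.

Lemma minorJ_alternating J : alternating (minorJ J).
Proof.
pose g := \matrix_(i < m, l < q) ((i == enumJ J l)%:R : F).
have E u : minorJ J u = \det (\matrix_(k, l) g (u k) l).
  by congr (\det _); apply/matrixP => a b; rewrite !mxE.
by move=> k l kl u; rewrite !E; apply: det_alternating.
Qed.

(** When J and J' differ, some element of J is not in J' and the corresponding
    column vanishes. *)
Lemma minorJ_enum J J' : minorJ J (enumJ J') = (J == J')%:R.
Proof.
rewrite /minorJ; have [->|JJ'] := eqVneq J J'.
  rewrite -[RHS](det1 F q); congr (\det _); apply/matrixP => k l.
  by rewrite !mxE (inj_eq (@enumJ_inj _)).
have [l lJ'] : exists l, enumJ J l \notin val J'.
  apply/existsP; apply: contraNT JJ'; rewrite negb_exists => /forallP JJ'.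
  apply/eqP/val_inj/eqP; rewrite eqEcard (eqP (valP J)) (eqP (valP J')) leqnn.
  rewrite andbT; apply/subsetP => i iJ.
  have := JJ' (cast_ord (eqP (valP J)) (enum_rank_in iJ i)).
  by rewrite negbK ffunE cast_ord_comp cast_ord_id enum_rankK_in.
rewrite (expand_det_col _ l) big1 // => k _; rewrite mxE.
case: eqP => [e|]; last by rewrite mul0r.
by move: lJ'; rewrite -e enumJ_in.
Qed.

End Alternating.

(** * Hook tensors *)

(** Evaluations at finitely many points that separate P and have a dual
    family are coordinates on P. *)
Lemma fdim_eval (F : fieldType) (X I : finType) (P : {ffun X -> F^o} -> Prop)
    (iota : I -> X) : subspace P ->
  (forall T : {ffun X -> F^o}, P T -> (forall i, T (iota i) = 0) -> T = 0) ->
  (forall i, exists2 T : {ffun X -> F^o}, P T &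
     forall j, T (iota j) = (i == j)%:R) ->
  fdim P #|I|.
Proof.
move=> [P0 Plin] P_inj; move=> dual.
have /choice[T TP] : forall i, exists T : {ffun X -> F^o}, P T /\
    forall j, T (iota j) = (i == j)%:R.
  by move=> i; have [T TP TE] := dual i; exists T.
pose phi (x : 'rV[F]_#|I|) : {ffun X -> F^o} := \sum_k x 0 k *: T (enum_val k).
have phi_lin : linear phi.
  move=> a x y; rewrite /phi scaler_sumr -big_split; apply: eq_bigr => i _.
  by rewrite !mxE scalerDl scalerA.
pose phiL : {linear _ -> _} := HB.pack phi
  (GRing.isLinear.Build _ _ _ _ phi phi_lin).
have phiE x i : phi x (iota i) = x 0 (enum_rank i).
  rewrite /phi sum_ffunE (bigD1 (enum_rank i)) //= ffunE (TP _).2.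
  rewrite enum_rankK eqxx big1 ?addr0 => [|k ki].
    by rewrite /GRing.scale /= mulr1.
  rewrite ffunE (TP _).2 -(inj_eq enum_rank_inj) enum_valK (negPf ki).
  by rewrite /GRing.scale /= mulr0.
have phiP x : P (phi x).
  by rewrite /phi; elim/big_ind: _ => // [T1 T2 P1 P2|k _];
    [rewrite -[T1]scale1r|rewrite -[_ *: _]addr0]; apply: Plin => //;
    apply: (TP _).1.
exists phiL.
  apply: linear_inj => x x0; apply/rowP => k.
  by rewrite mxE -[k]enum_valK -phiE [phi x]x0 ffunE.
move=> v; split=> [Pv|[x ->]]; last exact: phiP.
exists (\row_k v (iota (enum_val k))).
apply/eqP; rewrite -subr_eq0; apply/eqP; apply: P_inj.
  by rewrite addrC -scaleN1r; apply: Plin.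
by move=> i; rewrite !ffunE phiE mxE enum_rankK subrr.
Qed.

Section Hook.
Variables (F : numFieldType) (m r : nat).
Local Notation X := {ffun 'I_r.+2 -> 'I_m}.
Local Notation E := {ffun X -> F^o}.
Local Notation lift0 := (@lift r.+2 ord0).
Implicit Types (w : X) (T : E) (k l : 'I_r.+1).

Definition swap0 k : 'S_r.+2 := tperm ord0 (lift0 k).

Definition tail_alt T := forall k l, k != l ->
  forall w, T (wperm w (tperm (lift0 k) (lift0 l))) = - T w.

(** The relations T = sum_k T o (0 k) cut out the Schur module of the hook
    [2,1^r] in W tensor Lambda^(r+1) W. *)
Definition garnir T w : F := T w - \sum_k T (wperm w (swap0 k)).

Definition in_hook T := tail_alt T /\ forall w, garnir T w = 0.

Lemma tail_alt_subspace : subspace tail_alt.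
Proof.
split=> [k l kl w|a S T SA TA k l kl w]; first by rewrite !ffunE oppr0.
by rewrite !ffunE SA // TA // scalerN opprD.
Qed.

Definition garnir_fun T : E := [ffun w => garnir T w].

Lemma garnir_is_linear : linear garnir_fun.
Proof.
move=> a S T; apply/ffunP => w; rewrite !ffunE /garnir.
under eq_bigr => k _ do rewrite !ffunE.
by rewrite big_split -scaler_sumr !ffunE opprD addrACA -scalerBr.
Qed.
HB.instance Definition _ :=
  GRing.isLinear.Build F E E *:%R garnir_fun garnir_is_linear.

(** For a swap in the tail, conjugation permutes the swaps (0 k). For the swap
    (0 a), the product (0 k)(0 a) with k different from a is the tail swap (k a)
    times (0 k), so the terms are permuted up to the right sign. *)
Lemma garnir_alternating T : tail_alt T -> alternating (garnir T).
Proof.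
move=> TA.
have alt_tail k l w : k != l ->
    garnir T (wperm w (tperm (lift0 k) (lift0 l))) = - garnir T w.
  move=> kl; rewrite /garnir TA // -opprD; congr (- (_ + _)).
  rewrite (reindex_inj (@perm_inj _ (tperm k l))) -sumrN /=.
  apply: eq_bigr => a _.
  rewrite wpermM conjgC -wpermM; set t := tperm (lift0 k) _.
  have -> : (swap0 (tperm k l a) ^ t)%g = swap0 a.
    rewrite /swap0 tpermJ /t (@tpermD _ _ _ ord0) 1?eq_sym ?neq_lift //.
    by rewrite -inj_tperm ?tpermK //; apply: lift_inj.
  by rewrite TA.
have alt_sw a w : garnir T (wperm w (swap0 a)) = - garnir T w.
  rewrite /garnir (bigD1 a) //= [in RHS](bigD1 a) //= wperm_tpermK.
  have -> : \sum_(k | k != a) T (wperm (wperm w (swap0 a)) (swap0 k)) =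
      - \sum_(k | k != a) T (wperm w (swap0 k)).
    rewrite -sumrN; apply: eq_bigr => k ka; rewrite wpermM.
    have -> : (swap0 k * swap0 a = tperm (lift0 k) (lift0 a) * swap0 k)%g.
      have e0 : swap0 k ord0 = lift0 k by rewrite /swap0 tpermL.
      have ea : swap0 k (lift0 a) = lift0 a.
        by rewrite /swap0 tpermD ?neq_lift ?(inj_eq (@lift_inj _ ord0)).
      by rewrite conjgCV [(swap0 k)^-1%g]tpermV [swap0 a]/swap0 tpermJ -/(swap0 k) e0 ea.
    by rewrite -wpermM TA.
  by rewrite !opprD !opprK addrCA.
move=> x y xy w; have := xy.
case: (unliftP ord0 x) => [k|] ->; case: (unliftP ord0 y) => [l|] ->.
- by rewrite (inj_eq (@lift_inj _ ord0)) => /alt_tail.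
- by rewrite tpermC => _; apply: alt_sw.
- by move=> _; apply: alt_sw.
- by rewrite eqxx.
Qed.

Lemma garnir_full_alt T w : alternating T -> garnir T w = r.+2%:R * T w.
Proof.
move=> TA; rewrite /garnir.
under eq_bigr => k _ do rewrite TA ?neq_lift //.
rewrite sumr_const card_ord mulNrn opprK -mulrS mulr_natl.
by rewrite mulrS.
Qed.

(** The place 0 carries the factor W, the other places the exterior power. *)
Definition consX (a : 'I_m) (u : {ffun 'I_r.+1 -> 'I_m}) : X :=
  [ffun i => oapp u a (unlift ord0 i)].

Lemma consX0 a u : consX a u ord0 = a.
Proof. by rewrite ffunE unlift_none. Qed.

Lemma consXS a u k : consX a u (lift0 k) = u k.
Proof. by rewrite ffunE liftK. Qed.

Lemma consX_eta w : w = consX (w ord0) [ffun k => w (lift0 k)].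
Proof.
apply/ffunP => i; rewrite ffunE; case: unliftP => [k|] -> //=.
by rewrite ffunE.
Qed.

Lemma wperm_consX a u k l : wperm (consX a u) (tperm (lift0 k) (lift0 l)) =
  consX a (wperm u (tperm k l)).
Proof.
apply/ffunP => i; rewrite !ffunE; case: (unliftP ord0 i) => [j|] ->.
  rewrite -inj_tperm; last exact: lift_inj.
  by rewrite !liftK /= ffunE.
by rewrite tpermD ?unlift_none // eq_sym neq_lift.
Qed.

Lemma tail_alt_consX T a : tail_alt T ->
  alternating (fun u => T (consX a u)).
Proof. by move=> TA k l kl u; rewrite -wperm_consX TA. Qed.

Lemma tail_alt_ext S T : tail_alt S -> tail_alt T ->
  (forall a J, S (consX a (enumJ J)) = T (consX a (enumJ J))) -> S = T.
Proof.
move=> SA TA ST; apply/eqP; rewrite -subr_eq0; apply/eqP/ffunP => w.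
have [_ /(_ (-1) T S TA SA)] := tail_alt_subspace.
rewrite scaleN1r addrC => STA; rewrite (consX_eta w).
rewrite [RHS]ffunE; move: [ffun _ => _]; apply: alternating_eq0.
  exact: tail_alt_consX.
by move=> J; rewrite !ffunE ST subrr.
Qed.

Lemma fdim_tail_alt : fdim tail_alt (m * 'C(m, r.+1)).
Proof.
have -> : (m * 'C(m, r.+1) = #|{: 'I_m * subsetq m r.+1}|)%N.
  by rewrite card_prod card_ord card_subsetq.
apply: (fdim_eval (iota := fun x => consX x.1 (enumJ x.2))).
- exact: tail_alt_subspace.
- move=> T TA T0; apply: tail_alt_ext TA _ _; first by have [] := tail_alt_subspace.
  by move=> a J; rewrite (T0 (a, J)) ffunE.
move=> [a J]; exists ([ffun w : X => (w ord0 == a)%:R *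
    minorJ F J [ffun k => w (lift0 k)]] : E).
  move=> k l kl w; rewrite ffunE [X in _ = - X]ffunE.
  have -> : wperm w (tperm (lift0 k) (lift0 l)) ord0 = w ord0.
    by rewrite ffunE tpermD // eq_sym neq_lift.
  have -> : [ffun i => wperm w (tperm (lift0 k) (lift0 l)) (lift0 i)] =
      wperm [ffun i => w (lift0 i)] (tperm k l).
    by apply/ffunP => i; rewrite !ffunE -inj_tperm //; apply: lift_inj.
  by rewrite (minorJ_alternating F J kl) mulrN.
move=> [b J'] /=; rewrite ffunE consX0.
rewrite (_ : [ffun _ => _] = enumJ J'); last first.
  by apply/ffunP => k; rewrite ffunE consXS.
by rewrite minorJ_enum -natrM mulnb xpair_eqE eq_sym.
Qed.

Lemma fdim_full_alt : fdim (fun T : E => alternating T) 'C(m, r.+2).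
Proof.
rewrite -card_subsetq; apply: (fdim_eval (iota := @enumJ m r.+2)).
- split=> [k l kl w|a S T SA TA k l kl w]; first by rewrite !ffunE oppr0.
  by rewrite !ffunE SA // TA // scalerN opprD.
- move=> T TA T0; apply/ffunP => w; rewrite ffunE.
  exact: alternating_eq0 TA T0 w.
move=> J; exists ([ffun w : X => minorJ F J w] : E);
  last by move=> J'; rewrite ffunE minorJ_enum.
by move=> k l kl w; rewrite !ffunE minorJ_alternating.
Qed.

(** Rank-nullity for [garnir_fun] on the tail-alternating tensors, whose image is the
    space of alternating tensors: on these it is the multiplication by r + 2. *)
Lemma fdim_in_hook : fdim in_hook (r.+1 * 'C(m.+1, r.+2)).
Proof.
have [k [d [kd hk hd]]] := fdim_rank_nullity garnir_fun fdim_tail_alt.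
have dE : d = 'C(m, r.+2).
  apply: fdim_uniq hd (fdim_ext _ fdim_full_alt) => T; split=> [TA|[S SA ->]].
    have TA' : tail_alt T.
      by move=> a b ab w; apply: TA; rewrite (inj_eq (@lift_inj _ ord0)).
    exists (r.+2%:R^-1 *: T); first by rewrite -[_ *: _]addr0;
      have [T0 Tlin] := tail_alt_subspace; apply: Tlin.
    rewrite linearZ; apply/ffunP => w; rewrite !ffunE garnir_full_alt //.
    by rewrite /GRing.scale /= mulKf // pnatr_eq0.
  move=> a b ab w; rewrite !ffunE; exact: garnir_alternating.
have -> : (r.+1 * 'C(m.+1, r.+2) = k)%N.
  by have := hook_bin m r.+1; rewrite kd dE => /addIn.
apply: fdim_ext hk => T; split=> -[TA T0]; split=> //.
  by move=> w; have /ffunP/(_ w) := T0; rewrite !ffunE.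
by apply/ffunP => w; rewrite !ffunE T0.
Qed.

End Hook.

(** * Matrices acting on tensors *)

Lemma poly_eval0 (F : numFieldType) (p : {poly F}) :
  (forall x, p.[x] = 0) -> p = 0.
Proof.
move=> p0; pose rs : seq F := [seq k%:R | k <- iota 0 (size p)].
apply: (@roots_geq_poly_eq0 _ p rs).
- by apply/allP => x _; apply/eqP.
- by rewrite map_inj_uniq ?iota_uniq // => a b /eqP; rewrite eqr_nat => /eqP.
- by rewrite size_map size_iota.
Qed.

Section Tensor.
Variables (F : numFieldType) (m r : nat).
Local Notation X := {ffun 'I_r.+2 -> 'I_m}.
Local Notation E := {ffun X -> F^o}.
Local Notation lift0 := (@lift r.+2 ord0).
Implicit Types (w v : X) (T : E) (g h : 'M[F]_m).

Definition tensor_act g T : E :=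
  [ffun w : X => \sum_(v : X) (\prod_k g (w k) (v k)) * T v].

Lemma tensor_act_is_linear g : linear (tensor_act g).
Proof.
move=> a S T; apply/ffunP => w; rewrite !ffunE scaler_sumr -big_split.
by apply: eq_bigr => v _; rewrite !ffunE mulrDr scalerAr.
Qed.
HB.instance Definition _ g :=
  GRing.isLinear.Build F E E *:%R (tensor_act g) (tensor_act_is_linear g).

Lemma prod_delta w v : \prod_k (1%:M : 'M[F]_m) (w k) (v k) = (w == v)%:R.
Proof.
have [->|wv] := eqVneq w v; first by rewrite big1 // => k _; rewrite mxE eqxx.
have [k wvk] : exists k, w k != v k.
  apply/existsP; apply: contraNT wv; rewrite negb_exists => /forallP wv.
  by apply/eqP/ffunP => k; apply/eqP; have := wv k; rewrite negbK.
by rewrite (bigD1 k) //= mxE (negPf wvk) mul0r.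
Qed.

Lemma tensor_act1 T : tensor_act 1%:M T = T.
Proof.
apply/ffunP => w; rewrite ffunE (bigD1 w) //= prod_delta eqxx mul1r.
by rewrite big1 ?addr0 // => v /negPf vw; rewrite prod_delta eq_sym vw mul0r.
Qed.

Lemma tensor_actM g h T : tensor_act (g *m h) T = tensor_act g (tensor_act h T).
Proof.
apply/ffunP => w; rewrite !ffunE.
transitivity (\sum_(v : X) \sum_(u : X)
    (\prod_k (g (w k) (u k) * h (u k) (v k))) * T v : F).
  apply: eq_bigr => v _; rewrite -mulr_suml; congr (_ * _).
  under eq_bigr => k _ do rewrite mxE.
  by rewrite (bigA_distr_bigA (fun k i => g (w k) i * h i (v k))).
rewrite exchange_big; apply: eq_bigr => u _; rewrite ffunE mulr_sumr.
by apply: eq_bigr => v _; rewrite big_split /= mulrA.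
Qed.

Lemma tensor_act_wperm g T (s : 'S_r.+2) w :
  tensor_act g T (wperm w s) = tensor_act g [ffun v => T (wperm v s)] w.
Proof.
rewrite !ffunE [RHS](reindex_inj (h := fun v : X => wperm v s^-1%g)) /=; last first.
  by move=> v1 v2 /(congr1 (fun v => wperm v s)); rewrite !wpermM mulgV !wperm1.
apply: eq_bigr => v _; rewrite ffunE wpermM mulgV wperm1; congr (_ * _).
rewrite [RHS](reindex_inj (@perm_inj _ s)); apply: eq_bigr => k _.
by rewrite !ffunE permK.
Qed.

Lemma tensor_act_hook g T : in_hook T -> in_hook (tensor_act g T).
Proof.
move=> [TA T0]; split=> [k l kl w|w].
  rewrite tensor_act_wperm -[RHS]mulN1r.
  have -> : [ffun v => T (wperm v (tperm (lift0 k) (lift0 l)))] = (-1) *: T.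
    by apply/ffunP => v; rewrite !ffunE TA // scaleN1r.
  by rewrite linearZ ffunE.
rewrite /garnir; under eq_bigr => k _ do rewrite tensor_act_wperm.
rewrite -sum_ffunE -linear_sum /=.
have -> : \sum_k [ffun v => T (wperm v (swap0 k))] = T; last by rewrite subrr.
apply/ffunP => v; rewrite sum_ffunE; under eq_bigr => k _ do rewrite ffunE.
by apply/esym/eqP; rewrite -subr_eq0; apply/eqP/T0.
Qed.

Definition delta_fun (v : X) : E := [ffun w : X => (w == v)%:R].

Lemma sum_delta_fun T : T = \sum_w T w *: delta_fun w.
Proof.
apply/ffunP => u; rewrite sum_ffunE (bigD1 u) //= !ffunE eqxx big1 ?addr0.
  by rewrite /GRing.scale /= mulr1.
by move=> w /negPf wu; rewrite !ffunE eq_sym wu /GRing.scale /= mulr0.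
Qed.

Definition coefs (Q : X -> {poly F}) (i : nat) : E := [ffun w : X => (Q w)`_i].
Definition evals (Q : X -> {poly F}) (x : F) : E := [ffun w : X => (Q w).[x]].

(** Composing with coordinates of a linear map with kernel U yields polynomials
    that vanish outside the roots of d, hence vanish. *)
Lemma curve_coef (U : {vspace E}) (Q : X -> {poly F}) (d : {poly F}) :
  d != 0 -> (forall x, d.[x] != 0 -> evals Q x \in U) ->
  forall i, coefs Q i \in U.
Proof.
move=> d0 QU i.
pose pr (v : E) : E := v - projv U v.
have prU (v : E) : pr v = 0 -> v \in U.
  by move/eqP; rewrite subr_eq0 => /eqP->; apply: memv_proj.
have pr0 (v : E) : v \in U -> pr v = 0.
  by move=> vU; rewrite /pr projv_id // subrr.
have prE (v : E) u : pr v u = \sum_w v w * pr (delta_fun w) u.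
  rewrite {1}(sum_delta_fun v) /pr linear_sum -sumrB sum_ffunE; apply: eq_bigr => w _.
  by rewrite linearZ -scalerBr ffunE.
apply: prU; apply/ffunP => u; rewrite prE ffunE.
pose P := \sum_w (pr (delta_fun w) u : F) *: Q w.
have P0 : P = 0.
  have /eqP : P * d = 0.
    apply: poly_eval0 => x; rewrite hornerM.
    have [->|dx] := eqVneq d.[x] 0; first by rewrite mulr0.
    have := pr0 _ (QU x dx) => /ffunP/(_ u); rewrite prE ffunE => e.
    rewrite /P horner_sum (eq_bigr (fun w => evals Q x w * pr (delta_fun w) u : F)).
      by rewrite e mul0r.
    by move=> w _; rewrite hornerZ [evals _ _ _]ffunE mulrC.
  by rewrite mulf_eq0 (negPf d0) orbF => /eqP.
transitivity (P`_i); last by rewrite P0 coef0.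
by rewrite coef_sum; apply: eq_bigr => w _; rewrite [coefs _ _ _]ffunE coefZ mulrC.
Qed.

Lemma curve_eval (U : {vspace E}) (Q : X -> {poly F}) x :
  (forall i, coefs Q i \in U) -> evals Q x \in U.
Proof.
move=> QU; pose N := \max_w size (Q w).
have -> : evals Q x = \sum_(i < N) x ^+ i *: coefs Q i.
  apply/ffunP => w; rewrite ffunE sum_ffunE (horner_coef_wide _ (n := N)).
    by apply: eq_bigr => i _; rewrite !ffunE mulrC.
  exact: leq_bigmax.
by apply: memv_suml => i _; apply: memvZ.
Qed.

(** The coordinates of the action of g + x h on T, as polynomials in x. *)
Definition line_poly g h T w : {poly F} :=
  \sum_(v : X) (\prod_k ((g (w k) (v k))%:P + (h (w k) (v k))%:P * 'X)) * (T v : F)%:P.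

Lemma line_polyE g h T x :
  evals (line_poly g h T) x = tensor_act (g + x *: h) T.
Proof.
apply/ffunP => w; rewrite !ffunE /line_poly horner_sum; apply: eq_bigr => v _.
rewrite hornerM hornerC horner_prod; congr (_ * _); apply: eq_bigr => k _.
by rewrite !hornerE !mxE mulrC.
Qed.

Definition invariant (U : {vspace E}) :=
  forall g, g \in unitmx -> forall T, T \in U -> tensor_act g T \in U.

(** The line from the identity to g meets the singular matrices in finitely many
    points only. *)
Lemma invariant_singular U : invariant U ->
  forall g T, T \in U -> tensor_act g T \in U.
Proof.
move=> invU g T TU.
have -> : tensor_act g T = tensor_act (1%:M + 1 *: (g - 1%:M)) T.
  by rewrite scale1r addrC subrK.
rewrite -line_polyE; apply: curve_eval.
(* The determinant of dm is not zero: the line starts at the identity. *)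
pose dm : 'M[{poly F}]_m :=
  map_mx polyC 1%:M + map_mx polyC (g - 1%:M) *m ('X)%:M.
have dE x : (\det dm).[x] = \det (1%:M + x *: (g - 1%:M)).
  rewrite -[LHS]/(horner_eval x (\det dm)) -det_map_mx; congr (\det _).
  apply/matrixP => i j; rewrite /dm mul_mx_scalar !mxE /= /horner_eval.
  by rewrite hornerD hornerM !hornerC hornerX.
apply: (curve_coef (d := \det dm)).
  apply/eqP => /(congr1 (fun p : {poly F} => p.[0])).
  by rewrite dE scale0r addr0 det1 horner0 => /eqP; rewrite oner_eq0.
by move=> x dx; rewrite line_polyE; apply: invU => //; rewrite unitmxE unitfE -dE.
Qed.

End Tensor.

(** * The highest weight vector *)

Section HighestWeight.
Variables (F : numFieldType) (m r : nat).
Hypothesis rm : (r.+1 <= m)%N.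
Local Notation X := {ffun 'I_r.+2 -> 'I_m}.
Local Notation E := {ffun X -> F^o}.
Local Notation lift0 := (@lift r.+2 ord0).
Local Notation j := (widen_ord rm).
Implicit Types (w v : X) (T : E) (k l : 'I_r.+1) (g h : 'M[F]_m).

Lemma j_inj : injective j.
Proof. by move=> k l /(congr1 val)/= /val_inj. Qed.

(** The image of the highest weight vector under g ([tensor_act_hw]): the product
    of an entry in column 0 of g and a minor in the columns 0, ..., r. *)
Definition bideterminant g : E := [ffun w : X => g (w ord0) (j ord0) *
  \det (\matrix_(k, l) g (w (lift0 k)) (j l))].

Lemma bideterminant_tail_alt g : tail_alt (bideterminant g).
Proof.
move=> k l kl w; rewrite ffunE [X in _ = - X]ffunE -mulrN.
have -> : wperm w (tperm (lift0 k) (lift0 l)) ord0 = w ord0.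
  by rewrite ffunE tpermD // eq_sym neq_lift.
congr (_ * _).
pose g' := \matrix_(i < m, a < r.+1) g i (j a).
have E0 (w' : X) : \det (\matrix_(a, b) g (w' (lift0 a)) (j b)) =
    \det (\matrix_(a, b) g' ([ffun i => w' (lift0 i)] a) b).
  by congr (\det _); apply/matrixP => a b; rewrite !mxE ffunE.
rewrite !E0 -(det_alternating g' kl); congr (\det _).
apply/matrixP => a b; rewrite !mxE !ffunE -inj_tperm //; exact: lift_inj.
Qed.

(** The Garnir relation is Laplace expansion: in its right side row k of the
    minor A is replaced by the row u of the place 0, and expanding along this row
    and summing over k gives u (adj A A) e_0 = det A u_0. *)
Lemma bideterminant_hook g : in_hook (bideterminant g).
Proof.
split=> [|w]; first exact: bideterminant_tail_alt.
apply/eqP; rewrite /garnir subr_eq0 ffunE.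
pose A := \matrix_(k, l) g (w (lift0 k)) (j l).
pose u := \row_l g (w ord0) (j l).
have swE k : bideterminant g (wperm w (swap0 k)) =
    \sum_l u 0 l * (A k ord0 * cofactor A k l).
  rewrite ffunE.
  rewrite (_ : wperm w (swap0 k) ord0 = w (lift0 k)); last by rewrite ffunE tpermL.
  rewrite (expand_det_row _ k) mulr_sumr; apply: eq_bigr => l _.
  rewrite mulrCA; congr (_ * (_ * _)); rewrite ?mxE //.
    by rewrite ffunE tpermR.
  rewrite /cofactor; congr (_ * \det _); apply/matrixP => a b; rewrite !mxE.
  by rewrite ffunE tpermD ?neq_lift // (inj_eq (@lift_inj _ ord0)) neq_lift.
under eq_bigr => k _ do rewrite swE.
rewrite exchange_big /=; under eq_bigr => l _ do rewrite -mulr_sumr.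
have adjE l : \sum_k A k ord0 * cofactor A k l = \det A *+ (l == ord0).
  rewrite -[RHS](_ : (\adj A *m A) l ord0 = _); last by rewrite mul_adj_mx mxE.
  by rewrite mxE; apply: eq_bigr => k _; rewrite [\adj A _ _]mxE mulrC.
under eq_bigr => l _ do rewrite adjE.
rewrite (bigD1 ord0) //= big1 ?addr0 => [|l /negPf l0]; last first.
  by rewrite l0 mulr0n mulr0.
by rewrite mxE ?eqxx ?mulr1n.
Qed.

Definition hw : E := bideterminant 1%:M.

(** By the Leibniz formula hw is a signed sum of basis tensors, and g maps
    a basis tensor to a product of entries of columns of g. *)
Lemma tensor_act_hw g : tensor_act g hw = bideterminant g.
Proof.
pose c (s : 'S_r.+1) : X := consX (j ord0) [ffun k => j (s k)].
have hwE v : hw v = \sum_(s : 'S_r.+1) (-1) ^+ s * (v == c s)%:R.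
  rewrite ffunE /determinant mulr_sumr; apply: eq_bigr => s _.
  rewrite mulrCA; congr (_ * _); rewrite -prod_delta [RHS]big_ord_recl consX0.
  by congr (_ * _); apply: eq_bigr => k _; rewrite mxE consXS ffunE.
apply/ffunP => w; rewrite !ffunE.
under eq_bigr => v _ do rewrite hwE mulr_sumr.
rewrite exchange_big /determinant mulr_sumr; apply: eq_bigr => s _ /=.
rewrite (bigD1 (c s)) //= eqxx mulr1 [X in _ + X]big1 ?addr0 => [|v /negPf->]; last first.
  by rewrite !mulr0.
rewrite mulrC [RHS]mulrCA; congr (_ * _); rewrite [LHS]big_ord_recl consX0.
by congr (_ * _); apply: eq_bigr => k _; rewrite mxE consXS ffunE.
Qed.

(** A matrix that preserves the flag of the line of e_0 and the span of e_0, ..., e_r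
    scales hw; upper triangular matrices are of this form. *)
Lemma bideterminant_flag g (g' : 'M[F]_r.+1) :
  (forall i l, g i (j l) = \sum_l' (i == j l')%:R * g' l' l) ->
  (forall l', l' != ord0 -> g' l' ord0 = 0) ->
  bideterminant g = (g' ord0 ord0 * \det g') *: hw.
Proof.
move=> gg' g'0; apply/ffunP => w; rewrite !ffunE.
have -> : g (w ord0) (j ord0) = (w ord0 == j ord0)%:R * g' ord0 ord0.
  rewrite gg' (bigD1 ord0) //= big1 ?addr0 // => l' l0.
  by rewrite g'0 // mulr0.
have -> : \matrix_(k, l) g (w (lift0 k)) (j l) =
    (\matrix_(k, l) (1%:M : 'M[F]_m) (w (lift0 k)) (j l)) *m g'.
  by apply/matrixP => k l; rewrite !mxE gg'; apply: eq_bigr => a _; rewrite !mxE.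
by rewrite det_mulmx mxE /GRing.scale /=; ring.
Qed.

Lemma widen_sum (G : 'I_m -> F) (i : 'I_m) :
  (forall a : 'I_m, (r < a)%N -> G a = 0) ->
  \sum_(l < r.+1) (i == j l)%:R * G (j l) = G i.
Proof.
move=> G0; have [ir|ri] := leqP i r; last first.
  by rewrite G0 // big1 // => l _; case: eqP ri => [->|]; rewrite ?mul0r //=;
    rewrite ltnNge -ltnS ltn_ord.
have ir' : (i < r.+1)%N by [].
have ij : i = j (Ordinal ir') by apply: val_inj.
rewrite (bigD1 (Ordinal ir')) //= -ij eqxx mul1r big1 ?addr0 // => l li.
rewrite ij (inj_eq j_inj) eq_sym (negPf li) mul0r //.
Qed.

Lemma hw_unipotent g : (forall i, g i i = 1) ->
  (forall i l : 'I_m, (l < i)%N -> g i l = 0) -> tensor_act g hw = hw.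
Proof.
move=> g1 g0; rewrite tensor_act_hw.
rewrite (@bideterminant_flag g (\matrix_(l', l) g (j l') (j l))).
- rewrite mxE g1 mul1r -det_tr det_trig.
    by rewrite big1 ?scale1r // => l _; rewrite !mxE g1.
  by apply/is_trig_mxP => a b ab; rewrite !mxE g0.
- move=> i l; under eq_bigr => l' _ do rewrite mxE.
  rewrite (widen_sum (G := fun i => g i (j l))) // => a ra.
  by rewrite g0 //=; apply: leq_trans ra; rewrite ltnS -ltnS.
- by move=> l' l0; rewrite mxE g0 //= lt0n.
Qed.

Lemma hw_weight (t : 'rV[F]_m) : tensor_act (diag_mx t) hw =
  (\prod_i t 0 i ^+ nth 0%N (2%N :: nseq r 1%N) i) *: hw.
Proof.
rewrite tensor_act_hw (@bideterminant_flag _ (diag_mx (\row_l t 0 (j l)))).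
- rewrite det_diag !mxE eqxx mulr1n; congr (_ *: _).
  have tE i : t 0 i ^+ nth 0%N (2%N :: nseq r 1%N) i =
      (if i == j ord0 then t 0 i else 1) * (if (i < r.+1)%N then t 0 i else 1).
    rewrite -(inj_eq val_inj) /=; case: (nat_of_ord i) => [|a] /=.
      by rewrite expr2.
    by rewrite mul1r nth_nseq ltnS; case: ifP.
  under [RHS]eq_bigr => i _ do rewrite tE.
  rewrite [RHS]big_split /= -!big_mkcond big_pred1_eq /=.
  rewrite (big_ord_narrow rm); congr (_ * _).
  by apply: eq_bigr => l _; rewrite mxE.
- move=> i l; rewrite (bigD1 l) //= big1 ?addr0 => [|l' l'l].
    by rewrite !mxE eqxx mulr1n; case: eqP => [->|]; rewrite ?mul1r ?mul0r.
  by rewrite !mxE (negPf l'l) mulr0n mulr0.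
- by move=> l' l0; rewrite mxE (negPf l0).
Qed.

Definition top_index : X := consX (j ord0) [ffun k => j k].

Lemma hw_top_index : hw top_index = 1.
Proof.
rewrite ffunE consX0 mxE eqxx mul1r -[RHS](det1 F r.+1); congr (\det _).
apply/matrixP => k l; rewrite !mxE consXS ffunE.
by rewrite (inj_eq j_inj).
Qed.

Lemma hw_neq0 : hw != 0.
Proof.
by apply/eqP => /ffunP/(_ top_index); rewrite hw_top_index ffunE;
  apply/eqP; apply: oner_neq0.
Qed.

(** The coordinates of hw are integers, so the bilinear norm is a sum of squares of
    reals. *)
Lemma hw_norm : \sum_w hw w * hw w != 0 :> F.
Proof.
have hwR w : (hw w : F) \is Num.real.
  rewrite ffunE rpredM ?mxE ?rpred_nat // rpred_sum // => s _.
  rewrite rpredM ?rpredX ?rpredN ?rpred1 // rpred_prod // => k _.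
  by rewrite !mxE rpred_nat.
rewrite psumr_neq0; last by move=> w _; rewrite -expr2 -real_normK ?exprn_ge0.
by apply/hasP; exists top_index; rewrite ?mem_index_enum //= hw_top_index mulr1 ltr01.
Qed.

End HighestWeight.

(** * Irreducibility *)

Section Irreducible.
Variables (F : numFieldType) (m r : nat).
Hypothesis rm : (r.+1 <= m)%N.
Local Notation X := {ffun 'I_r.+2 -> 'I_m}.
Local Notation E := {ffun X -> F^o}.
Local Notation lift0 := (@lift r.+2 ord0).
Local Notation j := (widen_ord rm).
Local Notation hw := (hw F rm).
Implicit Types (w v : X) (T : E) (g h : 'M[F]_m).

Section InvariantSubspace.
Variable U : {vspace E}.
Hypothesis invU : invariant U.
Hypothesis hookU : forall T, T \in U -> in_hook T.

(** For a tensor nonzero at w, with w 0 = w 1, the matrix A w + x B w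
    sends e_(w 1) to x e_0, the other e_(w (k+1)) to e_k, and the remaining basis
    vectors to 0. The terms in x^2 of its action have the weight of hw. *)
Let c w (i : 'I_m) : 'I_m := w (lift0 (inord i)).
Let A w : 'M[F]_m := \matrix_(i, a) ((0 < i <= r)%N && (a == c w i))%:R.
Let B w : 'M[F]_m := \matrix_(i, a) ((i == 0 :> nat) && (a == c w i))%:R.

Lemma degenerate_curve T w v : line_poly (A w) (B w) T v =
  if [forall k, (v k <= r)%N] then
    (\prod_k (if v k == 0%N :> nat then 'X else 1)) *
      (T [ffun k => c w (v k)] : F)%:P
  else 0.
Proof.
have ME i a : (A w i a)%:P + (B w i a)%:P * 'X =
    if (i <= r)%N && (a == c w i)
    then (if i == 0 :> nat then 'X else 1) else 0 :> {poly F}.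
  rewrite !mxE; case: (a == c w i); rewrite ?andbF ?andbT ?mul0r ?addr0 //.
  have [->|i0] := posnP i; first by rewrite polyC0 add0r mul1r.
  by rewrite /= mul0r addr0; case: ifP.
have -> : line_poly (A w) (B w) T v = \sum_(u : X) (\prod_k
    (if (v k <= r)%N && (u k == c w (v k))
     then (if v k == 0 :> nat then 'X else 1) else 0)) * (T u : F)%:P.
  apply: eq_bigr => u _; congr (_ * _); apply: eq_bigr => k _; exact: ME.
case: ifP => [/forallP vr|/negP vr]; last first.
  have [k kr] : exists k, ~~ (v k <= r)%N.
    apply/existsP; rewrite -negb_forall; exact/negP.
  rewrite big1 // => u _; rewrite (bigD1 k) //= (negPf kr) /= !mul0r //.
rewrite (bigD1 [ffun k => c w (v k)]) //= [X in _ + X]big1 ?addr0.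
  by congr (_ * _); apply: eq_bigr => k _; rewrite vr ffunE eqxx.
move=> u /eqP uv.
have [k uk] : exists k, u k != c w (v k).
  apply/existsP; rewrite -negb_forall; apply/negP => /forallP h.
  by case: uv; apply/ffunP => k; rewrite ffunE; apply/eqP.
by rewrite (bigD1 k) //= (negPf uk) andbF !mul0r.
Qed.

(** The coefficient of x^2 in the degenerate curve lies in U, and its values on
    injective tails show that it is T w times hw. *)
Lemma hw_in_of_repeat0 T w : T \in U -> T w != 0 ->
  w ord0 = w (lift0 ord0) -> hw \in U.
Proof.
move=> TU Tw w01.
pose Q := line_poly (A w) (B w) T.
have fU : coefs Q 2 \in U.
  apply: (@curve_coef _ _ _ _ _ 1); first exact: oner_neq0.
  by move=> x _; rewrite line_polyE; apply: invariant_singular.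
have [fA _] := hookU fU.
have hA : tail_alt hw by have [] := bideterminant_hook rm (1%:M : 'M[F]_m).
suff fE : coefs Q 2 = T w *: hw.
  by rewrite -[hw]scale1r -(mulVf Tw) -scalerA memvZ // -fE.
apply/ffunP => v; rewrite (consX_eta v).
move: (v ord0) [ffun k => _] => a u {v}.
have fA' := tail_alt_consX a fA.
have hA' := tail_alt_consX a hA.
rewrite [RHS]ffunE.
(* Unless the tail permutes 0, ..., r both sides vanish at it. *)
have [ur|] := boolP [forall k, (u k <= r)%N]; last first.
  rewrite negb_forall => /existsP[k uk].
  rewrite ffunE /Q degenerate_curve ifF; last first.
    by apply/forallP => /(_ (lift0 k)); rewrite consXS; apply/negP.
  rewrite coef0 ffunE (expand_det_row _ k) big1 ?mulr0 ?scaler0 // => l _.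
  rewrite !mxE consXS; case: eqP uk => [->|]; rewrite ?mul0r //=.
  by rewrite -ltnS ltn_ord.
have [/injectiveP u_inj|] := boolP (injectiveb u); last first.
  move=> /injectivePn[k [l kl ukl]].
  rewrite (alternating_noninj fA' kl ukl) (alternating_noninj hA' kl ukl).
  by rewrite scaler0.
pose s0 (k : 'I_r.+1) : 'I_r.+1 := inord (u k).
have s0E k : j (s0 k) = u k.
  by apply: val_inj; rewrite /= inordK // ltnS; apply: (forallP ur).
have s0_inj : injective s0 by move=> k l e; apply: u_inj; rewrite -!s0E e.
pose u0 : {ffun 'I_r.+1 -> 'I_m} := [ffun k => j k].
have -> : u = wperm u0 (perm s0_inj).
  by apply/ffunP => k; rewrite !ffunE permE s0E.
rewrite (alternating_perm _ _ fA') (alternating_perm _ _ hA').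
rewrite /GRing.scale /= [RHS]mulrCA; congr (_ * _).
have hE : hw (consX a u0) = (a == j ord0)%:R.
  rewrite ffunE consX0 mxE (_ : \matrix_(_, _) _ = 1%:M) ?det1 ?mulr1 //.
  by apply/matrixP => k l; rewrite !mxE consXS ffunE (inj_eq (@j_inj _ _ rm)).
rewrite hE ffunE /Q degenerate_curve.
have [ar|ar] := leqP a r; last first.
  rewrite ifF ?coef0.
    by case: eqP ar => [->|]; rewrite ?mulr0.
  by apply/forallP => /(_ ord0); rewrite consX0 leqNgt ar.
rewrite ifT; last first.
  apply/forallP => k; case: (unliftP ord0 k) => [l|] ->; rewrite ?consX0 //.
  by rewrite consXS ffunE /= -ltnS.
rewrite big_ord_recl big_ord_recl [X in _ * (_ * X)]big1 => [|k _]; last first.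
  by rewrite consXS ffunE.
rewrite consX0 consXS ffunE /= mulr1 coefMC.
rewrite -(inj_eq val_inj) /=; case: (posnP a) => [a0|a0]; last first.
  by rewrite mul1r coefX mul0r mulr0.
rewrite -expr2 coefXn eqxx mul1r mulr1; congr (T _).
apply/ffunP => k; rewrite ffunE /c; case: (unliftP ord0 k) => [l|] ->.
  by rewrite consXS ffunE /= inord_val.
by rewrite consX0 a0 w01; congr (w (lift0 _)); apply: val_inj; rewrite /= inordK.
Qed.

Lemma hw_in_of_repeat T w k : T \in U -> T w != 0 ->
  w ord0 = w (lift0 k) -> hw \in U.
Proof.
move=> TU Tw wk; have [k0|k0] := eqVneq ord0 k.
  by apply: hw_in_of_repeat0 TU Tw _; rewrite k0.
have [TA _] := hookU TU.
apply: (@hw_in_of_repeat0 T (wperm w (tperm (lift0 ord0) (lift0 k)))) => //.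
  by rewrite TA // oppr_eq0.
by rewrite !ffunE tpermL tpermD // eq_sym neq_lift.
Qed.

(** If T vanishes at all indices where the first entry is repeated, the
    Garnir relation at w has a term T (w o (0 k)) different from - T w, as otherwise
    (r + 2) T w = 0. The transvection adding e_b to e_a, with a = w 0 and
    b = w (k+1), then produces a tensor with the nonzero value
    T w + T (w o (0 k)) at an index with repeated first entry. *)
Lemma hw_in_of_neq0 T w : T \in U -> T w != 0 -> hw \in U.
Proof.
move=> TU Tw.
have [/existsP[v /existsP[k /andP[Tv /eqP vk]]]|] := boolP
    [exists v, [exists k, (T v != 0) && (v ord0 == v (lift0 k))]].
  exact: hw_in_of_repeat TU Tv vk.
rewrite negb_exists => /forallP norep.
have rep0 v k : v ord0 = v (lift0 k) -> T v = 0.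
  move=> vk; apply/eqP; have := norep v; rewrite negb_exists => /forallP/(_ k).
  by rewrite vk eqxx andbT negbK.
have [TA T0] := hookU TU.
have [k Tk] : exists k, T w + T (wperm w (swap0 k)) != 0.
  apply/existsP; apply: contraNT Tw; rewrite negb_exists => /forallP h.
  have {}h k : T (wperm w (swap0 k)) = - T w.
    by apply/eqP; rewrite -addr_eq0 addrC; have := h k; rewrite negbK.
  have := T0 w; rewrite /garnir; under eq_bigr => k _ do rewrite h.
  rewrite sumr_const card_ord mulNrn opprK -mulrS => /eqP.
  by rewrite mulrn_eq0.
pose a := w ord0; pose b := w (lift0 k).
have ab : a != b by apply: contraNneq Tw => /rep0->.
have tail_inj l l' : w (lift0 l) = w (lift0 l') -> l = l'.
  move=> wl; apply: contraNeq Tw => ll'; apply/eqP.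
  pose u := [ffun i => w (lift0 i)].
  rewrite (consX_eta w); apply: (alternating_noninj (k := l) (l := l')
    (f := fun u => T (consX (w ord0) u))) => //; last by rewrite !ffunE.
  exact: tail_alt_consX.
pose g : 'M[F]_m := \matrix_(i, i') ((i == i') || (i == b) && (i' == a))%:R.
pose w' : X := [ffun i => if i == ord0 then b else w i].
have w'0 : w' ord0 = b by rewrite ffunE eqxx.
have w'S l : w' (lift0 l) = w (lift0 l) by rewrite ffunE eq_sym (negPf (neq_lift _ _)).
apply: (@hw_in_of_repeat (tensor_act g T) w' k); last by rewrite w'0 w'S.
  exact: invariant_singular.
have swk0 : wperm w (swap0 k) ord0 = b by rewrite ffunE tpermL.
have swkk : wperm w (swap0 k) (lift0 k) = a by rewrite ffunE tpermR.
have swkl l : l != k -> wperm w (swap0 k) (lift0 l) = w (lift0 l).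
  move=> lk; rewrite ffunE tpermD ?neq_lift // (inj_eq (@lift_inj _ ord0)).
  by rewrite eq_sym.
have wsw : wperm w (swap0 k) != w.
  by apply: contraNneq ab => e; rewrite -[X in _ == X]swk0 e.
have -> : tensor_act g T w' = T w + T (wperm w (swap0 k)); last exact: Tk.
rewrite ffunE (bigD1 w) //= (bigD1 (wperm w (swap0 k))) //=.
have -> : \prod_i g (w' i) (w i) = 1.
  rewrite big1 // => i _; rewrite mxE.
  by case: (unliftP ord0 i) => [l|] ->; rewrite ?w'0 ?w'S !eqxx ?orbT.
have -> : \prod_i g (w' i) (wperm w (swap0 k) i) = 1.
  rewrite big1 // => i _; rewrite mxE.
  case: (unliftP ord0 i) => [l|] ->; last by rewrite w'0 swk0 eqxx.
  rewrite w'S; have [->|/swkl->] := eqVneq l k; last by rewrite eqxx.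
  by rewrite swkk !eqxx orbT.
rewrite !mul1r [X in _ + (_ + X)]big1 ?addr0 //.
move=> v /andP[vw vsw].
have [->|Tv] := eqVneq (T v) 0; first by rewrite mulr0.
suff [i /negPf gi] : exists i, ~~ ((w' i == v i) || (w' i == b) && (v i == a)).
  by rewrite (bigD1 i) //= mxE gi !mul0r.
apply/existsP; rewrite -negb_forall; apply/negP => /forallP h.
have vl l : l != k -> v (lift0 l) = w (lift0 l).
  move=> lk; have := h (lift0 l); rewrite w'S => /orP[/eqP->//|/andP[/eqP wb _]].
  by case/eqP: lk; apply: tail_inj.
have := h ord0; have := h (lift0 k); rewrite w'S w'0 !eqxx /=.
have v0k : v ord0 != v (lift0 k) by apply: contraNneq Tv => /rep0->.
move=> /orP[]/eqP vk /orP[]/eqP v0.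
- by move: v0k; rewrite -v0 -vk eqxx.
- case/eqP: vw; apply/ffunP => i; case: (unliftP ord0 i) => [l|] ->; rewrite ?v0 //.
  by have [->|/vl//] := eqVneq l k.
- case/eqP: vsw; apply/ffunP => i; case: (unliftP ord0 i) => [l|] ->.
    have [->|lk] := eqVneq l k; first by rewrite swkk.
    by rewrite swkl ?vl.
  by rewrite swk0.
- by move: v0k; rewrite v0 vk eqxx.
Qed.

Lemma hw_in : U != 0%VS -> hw \in U.
Proof.
rewrite -vpick0 => U0; have [w Tw] : exists w, vpick U w != 0.
  apply/existsP; apply: contraNT U0; rewrite negb_exists => /forallP h.
  by apply/eqP/ffunP => w; rewrite ffunE; apply/eqP; have := h w; rewrite negbK.
exact: hw_in_of_neq0 (memv_pick U) Tw.
Qed.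

End InvariantSubspace.

Definition pairing (S T : E) : F := \sum_w S w * T w.

(** The form is contravariant: the adjoint of g is its transpose. *)
Lemma pairing_tensor_act g S T :
  pairing (tensor_act g S) T = pairing S (tensor_act g^T T).
Proof.
rewrite /pairing; under eq_bigr => w _ do rewrite ffunE mulr_suml.
rewrite exchange_big; apply: eq_bigr => v _; rewrite ffunE mulr_sumr.
apply: eq_bigr => w _; rewrite mulrAC mulrC; congr (_ * (_ * _)).
by apply: eq_bigr => k _; rewrite mxE.
Qed.

(** The elements of V orthogonal to U form an invariant subspace, nonzero when
    U is proper by a dimension count, so both would contain hw. *)
Lemma hook_irreducible (V U : {vspace E}) :
  (forall T, in_hook T <-> T \in V) -> (U <= V)%VS -> invariant U ->
  U = 0%VS \/ U = V.
Proof.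
move=> VP UV invU; have [->|U0] := eqVneq U 0%VS; first by left.
right; apply/eqP; rewrite eqEdim UV leqNgt; apply/negP => dimUV.
have hookU T : T \in U -> in_hook T by move=> /(subvP UV)/VP.
have hwU := hw_in invU hookU U0.
pose f (T : E) : 'rV[F]_(\dim U) := \row_i pairing T (vbasis U)`_i.
have f_lin : linear f.
  move=> x S T; apply/rowP => i; rewrite !mxE /pairing mulr_sumr -big_split.
  by apply: eq_bigr => w _; rewrite !ffunE mulrDl mulrA.
pose fL : {linear _ -> _} := HB.pack f (GRing.isLinear.Build _ _ _ _ f f_lin).
have dV := @fdim_vspace F E V E (idfun : {linear E -> E}) (fun x _ e => e).
have [k [d [dE hk hd]]] := fdim_rank_nullity fL dV.
have d_le : (d <= \dim U)%N.
  apply: (@fdim_le _ _ _ (fun=> True) _ _ _ hd) => //.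
  by exists (idfun : {linear _ -> _}) => // x; split=> // _; exists x.
(* The orthogonal of U in V. *)
have [U' U'P] : exists U' : {vspace E}, forall T,
    (in_hook T /\ f T = 0) <-> T \in U'.
  apply: subspace_vspace; split=> [|x S T [/VP SV S0] [/VP TV T_0]].
    by split; [apply/VP; rewrite mem0v|exact: (linear0 fL)].
  split; first by apply/VP; rewrite memvD // memvZ.
  by rewrite f_lin S0 T_0 scaler0 addr0.
have dimU' : \dim U' = k.
  have dU' := @fdim_vspace F E U' E (idfun : {linear E -> E}) (fun x _ e => e).
  apply: fdim_uniq dU' (fdim_ext _ hk) => T; split.
    move=> [[S SV ->] fT]; exists S => //; apply/U'P; split=> //; exact/VP.
  move=> [S /U'P[/VP SV fS] ->]; split=> //; by exists S.
have U'0 : U' != 0%VS by rewrite -dimv_eq0 dimU'; lia.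
have orth T S : f T = 0 -> S \in U -> pairing T S = 0.
  move=> fT SU; rewrite (coord_vbasis SU) /pairing.
  under eq_bigr => w _ do rewrite sum_ffunE mulr_sumr.
  rewrite exchange_big big1 // => i _.
  have /rowP/(_ i) := fT; rewrite !mxE /pairing => e.
  under eq_bigr => w _ do rewrite ffunE mulrCA.
  by rewrite -mulr_sumr e mulr0.
have invU' : invariant U'.
  move=> g gu T /U'P[TV fT]; apply/U'P; split; first exact: tensor_act_hook.
  apply/rowP => i; rewrite !mxE pairing_tensor_act; apply: orth => //.
  by apply: invU; rewrite ?unitmx_tr // vbasis_mem // mem_nth ?size_tuple.
have hookU' T : T \in U' -> in_hook T by case/U'P.
have /U'P[_ /orth/(_ hwU)/eqP] := hw_in invU' hookU' U'0.
exact/negP/hw_norm.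
Qed.

End Irreducible.

(** * The hook module and the theorem *)

Section HookModule.
Variables (F : numFieldType) (m r : nat).
Hypothesis rm : (r.+1 <= m)%N.
Local Notation X := {ffun 'I_r.+2 -> 'I_m}.
Local Notation E := {ffun X -> F^o}.

(** The space of hook tensors with the action of [tensor_act]. *)
Lemma hook_pi : exists2 V : vectType F,
  is_pi m (2%N :: nseq r 1%N) V &
  \dim (fullv : {vspace V}) = (r.+1 * 'C(m.+1, r.+2))%N.
Proof.
have [U UP] : exists U : {vspace E}, forall T, in_hook T <-> T \in U.
  apply: subspace_vspace; split=> [|a S T [SA S0] [TA T0]].
    by split=> [k l kl w|w]; rewrite /garnir ?ffunE ?oppr0 // big1 ?subr0 // => k _;
      rewrite ffunE.
  have [_ Tlin] := tail_alt_subspace F m r.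
  split=> [|w]; first exact: Tlin.
  have := garnir_is_linear a S T => /ffunP/(_ w).
  by rewrite !ffunE S0 T0 scaler0 addr0.
have dimU : \dim U = (r.+1 * 'C(m.+1, r.+2))%N.
  have dU := @fdim_vspace F E U E (idfun : {linear E -> E}) (fun x _ e => e).
  apply: fdim_uniq dU (fdim_ext _ (fdim_in_hook F m r)) => T; split.
    by move=> /UP TU; exists T.
  by move=> [S SU ->]; apply/UP.
have tensU g T : T \in U -> tensor_act g T \in U.
  by move=> /UP /tensor_act_hook/UP.
exists (subvs_of U); last by rewrite dimvf.
rewrite /is_pi /= size_nseq rm.
pose rho g : 'End(subvs_of U) := linfun (vsproj U \o tensor_act g \o vsval).
have rhoE g x : vsval (rho g x) = tensor_act g (vsval x).
  by rewrite lfunE /= vsprojK // tensU // subvsP.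
have hwU : hw F rm \in U by apply/UP/bideterminant_hook.
exists rho; split.
- split=> [|g h _ _]; apply/lfunP => x; apply: subvs_inj.
    by rewrite rhoE tensor_act1 id_lfunE.
  by rewrite comp_lfunE !rhoE tensor_actM.
- move=> l x.
  exists (\sum_(w : X) \sum_(v : X)
    ((vsval x v : F) * (l (vsproj U (delta_fun F w)) : F))%:MP *
    \prod_k 'X_(mxvec_index (w k) (v k))) => g _.
  have -> : rho g x = \sum_w tensor_act g (vsval x) w *: vsproj U (delta_fun F w).
    rewrite lfunE /= [tensor_act g _ in LHS]sum_delta_fun linear_sum.
    by apply: eq_bigr => w _; rewrite linearZ.
  rewrite linear_sum rmorph_sum; apply: eq_bigr => w _ /=.
  rewrite linearZ rmorph_sum /= [tensor_act _ _ _]ffunE /GRing.scale /= mulr_suml.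
  apply: eq_bigr => v _ /=.
  rewrite mevalM mevalC rmorph_prod /= -mulrA mulrC; congr (_ * _).
  by apply: eq_bigr => k _; rewrite mevalXU mxvecE.
- split.
    apply/eqP => U0; have := memvf (vsproj U (hw F rm)); rewrite U0 memv0.
    rewrite -(inj_eq (@subvs_inj _ _ _)) vsprojK // linear0.
    exact/negP/hw_neq0.
  move=> W invW; pose W' := (linfun (@vsval _ _ U) @: W)%VS.
  have W'P x : (vsval x \in W') = (x \in W).
    apply/idP/idP => [/memv_imgP[y yW]|xW]; first by rewrite lfunE => /subvs_inj->.
    by apply/memv_imgP; exists x; rewrite ?lfunE.
  have W'U : (W' <= U)%VS.
    by apply/subvP => _ /memv_imgP[y _ ->]; rewrite lfunE /= subvsP.
  have invW' : invariant W'.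
    move=> g gu _ /memv_imgP[y yW ->]; rewrite lfunE /= -rhoE W'P.
    by apply: (subvP (invW g gu)); apply: memv_img.
  case: (hook_irreducible rm UP W'U invW') => W'E; [left|right].
    apply/eqP; rewrite -subv0; apply/subvP => x; rewrite -W'P W'E !memv0.
    by move=> /eqP x0; apply/eqP/subvs_inj; rewrite x0 linear0.
  by apply/vspaceP => x; rewrite -W'P W'E subvsP memvf.
exists (vsproj U (hw F rm)).
  rewrite -(inj_eq (@subvs_inj _ _ _)) vsprojK // linear0; exact: hw_neq0.
split=> [g g1 g0|t _]; apply: subvs_inj; rewrite rhoE !vsprojK //.
  exact: hw_unipotent.
by rewrite linearZ /= vsprojK // hw_weight.
Qed.

End HookModule.

Import VectorInternalTheory.

Lemma vect_iso_dim (F : fieldType) (U V : vectType F) :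
  \dim {:U} = \dim {:V} -> vect_iso U V.
Proof.
rewrite !dimvf => e.
have [c c_bij] : exists c : {linear 'rV[F]_(dim U) -> 'rV[F]_(dim V)}, bijective c.
  by rewrite -e; exists idfun; exists idfun.
exists (r2v \o c \o v2r : {linear U -> V}).
apply: bij_comp; last by exists r2v; [exact: v2rK|exact: r2vK].
by apply: bij_comp => //; exists v2r; [exact: r2vK|exact: v2rK].
Qed.

Theorem corollary4p3p1 (R : realType) (n : nat) (hn : (1 <= n)%N)
    (G : graded_resolution (veronese_proj R[i] n)) :
  [/\ vect_iso (tor G 0 0) (R[i])^o,
      forall p q : nat, \dim (fullv : {vspace tor G p q}) <> 0%N ->
        (p = 0%N /\ q = 0%N) \/ ((1 <= p)%N /\ q = p.+1),
      forall p : nat, (1 <= p)%N ->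
        exists V : vectType R[i],
          is_pi n.-1 (2%N :: nseq p.-1 1%N) V /\ vect_iso (tor G p p.+1) V
    & forall p : nat, (1 <= p)%N ->
        \dim (fullv : {vspace tor G p p.+1}) = (p * 'C(n, p.+1))%N].
Proof.
split.
- by apply: vect_iso_dim; rewrite tor00 dimvf.
- move=> p q; have [/andP[/eqP-> /eqP->]|pq] := boolP ((p == 0) && (q == 0))%N.
    by left.
  have [->|qp] := eqVneq q p.+1.
    case: p {pq} => [|p]; last by right.
    by rewrite dim_tor_linear.
  by rewrite tor_vanish // -negb_and.
- case=> // r _ /=.
  have [rm|mr] := leqP r.+1 n.-1.
    have [V Vpi dV] := hook_pi R[i] rm.
    by exists V; split=> //; apply: vect_iso_dim; rewrite dV dim_tor_linear // prednK.
  exists (tor G r.+1 r.+2); split; last by apply: vect_iso_dim.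
  rewrite /is_pi /= size_nseq leqNgt mr /=; apply/eqP; rewrite -dimv_eq0.
  by rewrite dim_tor_linear // bin_small ?muln0 //; lia.
- by move=> p _; apply: dim_tor_linear.
Qed.
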